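(* Let $J\subset J_1\subset F[d_x,d_y]$ be non-holonomic left ideals (of differential type $1$), let $J_1=\langle p_1,\dots,p_t\rangle$, and let $G=G_{s_2,\dots,s_k}(f_1,\dots,f_k)$ with $(d_xf_1,d_yf_1)\neq(0,0)$. Then there is an isomorphism of $C$-vector spaces $$V_G(J)/V_G(J_1)\;\cong\;V_G(\mathrm{Syz}(J,J_1)).$$
   Context: $F$ is a differentially closed (universal in the sense of Kolchin) differential field of characteristic $0$ with two commuting derivations $d_x,d_y$, and $C\subset F$ is its subfield of constants; $F[d_x,d_y]$ is the ring of linear partial differential operators over $F$, and $\langle\cdot\rangle$ denotes the generated left ideal. The differential type of a left ideal is the degree of its Hilbert–Kolchin polynomial (equal for large integers $z$ to $\dim_F$ of the operators of order $\le z$ modulo those lying in the ideal). The left module of relative syzygies is $$\mathrm{Syz}(J,J_1)=\Bigl\{(q_1,\dots,q_t)\in F[d_x,d_y]^t:\ \sum_{1\le i\le t}q_ip_i\in J\Bigr\}.$$ Let $k\ge1$, let $1>s_2>\cdots>s_k>0$ be rational and $f_1,\dots,f_k\in F$. The symbol $G=G^{(0)}=G_{s_2,\dots,s_k}(f_1,\dots,f_k)$ comes with $F$-linearly independent formal symbols $\{G^{(s)}\}_{s\in\mathbb Q}$ and the rule $dG^{(s)}=(df_1)G^{(1+s)}+(df_2)G^{(s_2+s)}+\cdots+(df_k)G^{(s_k+s)}$ for $d\in\{d_x,d_y\}$. With $q$ the common denominator of $s_2,\dots,s_k$ ($q=1$ if $k=1$), a fractional-derivatives series is a formal series $H=\sum_{0\le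 i<\infty}h_iG^{(s_0-i/q)}$ with $h_i\in F$, $s_0q\in\mathbb Z$. $V_G$ is the set of all these series (for the given $G$) together with $0$; it is an $F[d_x,d_y]$-module, operators acting termwise via the Leibniz rule and the rule above. For a left ideal $I$, $V_G(I)=\{H\in V_G: pH=0\text{ for all }p\in I\}$; for a left submodule $S\subset F[d_x,d_y]^t$, $V_G(S)=\{(w_1,\dots,w_t)\in V_G^t:\sum_iq_iw_i=0\text{ for all }(q_1,\dots,q_t)\in S\}$. *)

(* Defs.v *)
From HB Require Import structures.
From mathcomp Require Import all_boot all_order all_algebra.
From mathcomp Require Import boolp classical_sets functions.

Set Implicit Arguments.
Unset Strict Implicit.
Unset Printing Implicit Defensive.

Import Order.TTheory GRing.Theory Num.Theory.

Local Open Scope ring_scope.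
Local Open Scope classical_set_scope.

HB.mixin Record Field_isPDiffField F of GRing.Field F := {
  dx : F -> F;
  dy : F -> F;
  dxD : {morph dx : a b / a + b};
  dyD : {morph dy : a b / a + b};
  dxM : forall a b, dx (a * b) = dx a * b + a * dx b;
  dyM : forall a b, dy (a * b) = dy a * b + a * dy b;
  dxdyC : forall a, dx (dy a) = dy (dx a)
}.

#[short(type="pdiffFieldType")]
HB.structure Definition PDiffField := {F of GRing.Field F & Field_isPDiffField F}.

Section DerivationTheory.
Variable F : pdiffFieldType.
Implicit Types a b : F.

Lemma additive_zmod_morphism (U V : zmodType) (d : U -> V) :
  {morph d : a b / a + b} -> zmod_morphism d.
Proof.
move=> dD a b.
have d0 : d 0 = 0 by apply: (addIr (d 0)); rewrite -dD !add0r.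
have dN : d (- b) = - d b by apply: (addIr (d b)); rewrite -dD !addNr.
by rewrite dD dN.
Qed.

HB.instance Definition _ := GRing.isZmodMorphism.Build F F dx
  (additive_zmod_morphism (@dxD F)).
HB.instance Definition _ := GRing.isZmodMorphism.Build F F dy
  (additive_zmod_morphism (@dyD F)).

Lemma derivation1 (d : {additive F -> F}) :
  (forall a b, d (a * b) = d a * b + a * d b) -> d 1 = 0.
Proof.
by move=> dM; apply: (addIr (d 1)); rewrite -{3}[1]mulr1 dM mulr1 mul1r add0r.
Qed.

Lemma derivationV (d : {additive F -> F}) a :
  (forall a b, d (a * b) = d a * b + a * d b) -> d a = 0 -> d a^-1 = 0.
Proof.
move=> dM da; have [->|a0] := eqVneq a 0; first by rewrite invr0 raddf0.
have := derivation1 dM; rewrite -(mulfV a0) dM da mul0r add0r => /eqP.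
by rewrite mulf_eq0 (negPf a0) => /eqP.
Qed.

Definition is_const : {pred F} := [pred c | (dx c == 0) && (dy c == 0)].

Lemma is_const_divring_closed : divring_closed is_const.
Proof.
have dx1 := derivation1 (@dxM F); have dy1 := derivation1 (@dyM F).
split=> [|a b|a b]; rewrite !inE; first by rewrite dx1 dy1 eqxx.
  by move=> /andP[/eqP ax /eqP ay] /andP[/eqP bx /eqP by_];
     rewrite !raddfB /= ax ay bx by_ subrr eqxx.
move=> /andP[/eqP ax /eqP ay] /andP[/eqP bx /eqP by_].
by rewrite dxM dyM ax ay (derivationV (@dxM F)) ?(derivationV (@dyM F)) //
           !mul0r !mulr0 addr0 eqxx.
Qed.

HB.instance Definition _ := GRing.isDivringClosed.Build F is_const
  is_const_divring_closed.

Record constants := Constant { const_val : F; _ : const_val \in is_const }.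

HB.instance Definition _ := [isSub for const_val].
HB.instance Definition _ := [Choice of constants by <:].
HB.instance Definition _ := [SubChoice_isSubIntegralDomain of constants by <:].
HB.instance Definition _ := [SubIntegralDomain_isSubField of constants by <:].

Lemma dx_const (c : constants) : dx (val c) = 0.
Proof. by case: c => c /=; rewrite inE => /andP[/eqP]. Qed.

Lemma dy_const (c : constants) : dy (val c) = 0.
Proof. by case: c => c /=; rewrite inE => /andP[_ /eqP]. Qed.

End DerivationTheory.

Definition diff_morphism (K E : pdiffFieldType) (j : {rmorphism K -> E}) :=
  (forall a, j (dx a) = dx (j a)) /\ (forall a, j (dy a) = dy (j a)).

Definition diff_subfield (E : pdiffFieldType) (S : set E) :=
  [/\ S 1, forall a b, S a -> S b -> S (a - b),
      forall a b, S a -> S b -> S (a / b)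
    & forall a, S a -> S (dx a) /\ S (dy a)].

(* [E] is generated, as a differential field, by [B] and finitely many
   elements. *)
Definition diff_fin_generated (E : pdiffFieldType) (B : set E) :=
  exists s : seq E, forall S : set E, diff_subfield S -> B `<=` S ->
    (forall a, a \in s -> S a) -> S = setT.

(* Differential polynomials in the unknowns u_0, u_1, ...; [DVar n a b] is
   dx^a dy^b u_n. *)
Inductive diff_poly (F : Type) : Type :=
| DConst of F
| DVar of nat & nat & nat
| DAdd of diff_poly F & diff_poly F
| DMul of diff_poly F & diff_poly F.

Fixpoint diff_poly_eval (F : Type) (E : pdiffFieldType) (j : F -> E)
    (u : nat -> E) (P : diff_poly F) : E :=
  match P with
  | DConst a => j a
  | DVar n a b => iter a dx (iter b dy (u n))
  | DAdd P Q => diff_poly_eval j u P + diff_poly_eval j u Q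
  | DMul P Q => diff_poly_eval j u P * diff_poly_eval j u Q
  end.

(* Every finite system over [F] solvable in some differential field extension
   is solvable in [F].  Inequations are covered, since Q <> 0 amounts to
   Q * z = 1 for a new unknown z. *)
Definition differentially_closed (F : pdiffFieldType) :=
  forall (E : pdiffFieldType) (j : {rmorphism F -> E}), diff_morphism j ->
  forall sys : seq (diff_poly F),
    (exists u : nat -> E, all (fun P => diff_poly_eval j u P == 0) sys) ->
    exists u : nat -> F, all (fun P => diff_poly_eval id u P == 0) sys.

(* Kolchin: for every differential subfield [K] of [F] that is finitely
   generated over the prime field, every finitely generated differential
   extension of [K] embeds into [F] over [K]. *)
Definition kolchin_universal (F : pdiffFieldType) :=
  forall (K E : pdiffFieldType)
    (i : {rmorphism K -> F}) (j : {rmorphism K -> E}),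
    diff_morphism i -> diff_morphism j ->
    diff_fin_generated (set0 : set K) ->
    diff_fin_generated (range j) ->
    exists2 h : {rmorphism E -> F}, diff_morphism h & forall a, h (j a) = i a.

Section PolySum.
Variables (R : nzSemiRingType) (M : zmodType).
Implicit Types (g : R -> nat -> M) (p : {poly R}).

Definition polysum g p : M := \sum_(i < size p) g p`_i i.

Lemma polysum_widen g p n : (forall i, g 0 i = 0) -> (size p <= n)%N ->
  polysum g p = \sum_(i < n) g p`_i i.
Proof.
move=> g0 pn; rewrite /polysum (big_ord_widen _ (fun i => g p`_i i) pn).
rewrite big_mkcond; apply: eq_bigr => i _; case: ltnP => // ip.
by rewrite nth_default.
Qed.

Lemma polysumD g p q : (forall i, {morph g^~ i : a b / a + b}) ->
  (forall i, g 0 i = 0) -> polysum g (p + q) = polysum g p + polysum g q.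
Proof.
move=> gD g0; have := size_polyD p q.
set n := maxn _ _ => pq.
rewrite !(@polysum_widen _ _ n) // ?leq_maxl ?leq_maxr // -big_split.
by apply: eq_bigr => i _; rewrite coefD gD.
Qed.

Lemma polysum0 g : polysum g 0 = 0.
Proof. by rewrite /polysum size_poly0 big_ord0. Qed.

Lemma polysumC g c : (forall i, g 0 i = 0) -> polysum g c%:P = g c 0%N.
Proof.
move=> g0; rewrite (@polysum_widen _ _ 1%N) ?size_polyC_leq1 //.
by rewrite big_ord1 coefC eqxx.
Qed.

Lemma polysumMX g p : (forall i, g 0 i = 0) ->
  polysum g (p * 'X) = polysum (fun a i => g a i.+1) p.
Proof.
move=> g0; rewrite (@polysum_widen _ _ (size p).+1) //; last first.
  by have [->|p0] := eqVneq p 0; rewrite ?mul0r ?size_poly0 // size_mulX.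
rewrite big_ord_recl coefMX eqxx g0 add0r.
by apply: eq_bigr => i _; rewrite coefMX.
Qed.

Lemma polysum_map g (h : R -> R) p : (forall i, g 0 i = 0) -> h 0 = 0 ->
  polysum g (map_poly h p) = polysum (fun a i => g (h a) i) p.
Proof.
move=> g0 h0; rewrite (@polysum_widen _ _ (size p)) ?size_poly //.
by apply: eq_bigr => i _; rewrite coef_map_id0.
Qed.

Lemma eq_polysum g h p : (forall a i, g a i = h a i) ->
  polysum g p = polysum h p.
Proof. by move=> gh; apply: eq_bigr. Qed.

Lemma polysum_split g h p :
  polysum (fun a i => g a i + h a i) p = polysum g p + polysum h p.
Proof. exact: big_split. Qed.

End PolySum.

(* The operator sum_(i, j) a_ij dx^i dy^j is stored as the polynomial [p] with
   p`_i`_j = a_ij: coefficients stand to the left of the derivations. *)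
Definition lpdo (F : pdiffFieldType) : Type := {poly {poly F}}.

HB.instance Definition _ (F : pdiffFieldType) :=
  GRing.Zmodule.copy (lpdo F) {poly {poly F}}.

(* An additive group with an action [sc] of [F] and two commuting maps [ex] and
   [ey] obeying the Leibniz rule is a left module over F[dx, dy]. *)
Record leibniz_action (F : pdiffFieldType) (M : zmodType) (sc : F -> M -> M)
    (ex ey : M -> M) : Prop := LeibnizAction {
  lscA : forall a b w, sc a (sc b w) = sc (a * b) w;
  lsc1 : forall w, sc 1 w = w;
  lscDl : forall w, {morph sc^~ w : a b / a + b};
  lscDr : forall a, {morph sc a : v w / v + w};
  lexD : {morph ex : v w / v + w};
  leyD : {morph ey : v w / v + w};
  lexZ : forall a w, ex (sc a w) = sc (dx a) w + sc a (ex w);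
  leyZ : forall a w, ey (sc a w) = sc (dy a) w + sc a (ey w);
  lexyC : forall w, ex (ey w) = ey (ex w)
}.

Definition lpdo_eval (F : pdiffFieldType) (M : zmodType) (sc : F -> M -> M)
    (ex ey : M -> M) (p : lpdo F) (w : M) : M :=
  \sum_(i < size p) \sum_(j < size p`_i) sc p`_i`_j (iter i ex (iter j ey w)).

Definition lpdo_scale (F : pdiffFieldType) (a : F) (p : lpdo F) : lpdo F :=
  a%:P *: (p : {poly {poly F}}).
(* Left multiplication by dx is p |-> sum (dx a_ij) dx^i dy^j + a_ij dx^(i+1) dy^j. *)
Definition lpdo_dx (F : pdiffFieldType) (p : lpdo F) : lpdo F :=
  (p : {poly {poly F}}) * 'X + map_poly (map_poly dx) p.
Definition lpdo_dy (F : pdiffFieldType) (p : lpdo F) : lpdo F :=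
  'X *: (p : {poly {poly F}}) + map_poly (map_poly dy) p.

Definition lpdo_mul (F : pdiffFieldType) (p q : lpdo F) : lpdo F :=
  lpdo_eval (@lpdo_scale F) (@lpdo_dx F) (@lpdo_dy F) p q.

Section LpdoEvalTheory.
Variables (F : pdiffFieldType) (M : zmodType) (sc : F -> M -> M).
Variables (ex ey : M -> M) (L : leibniz_action sc ex ey).
Implicit Types (p q : lpdo F) (u v : {poly F}) (w z : M) (a : F).

Let sc0 w : sc 0 w = 0.
Proof. by apply: (addIr (sc 0 w)); rewrite -(lscDl L) !add0r. Qed.
Let scr0 a : sc a 0 = 0.
Proof. by apply: (addIr (sc a 0)); rewrite -(lscDr L) !add0r. Qed.
Let ex0 : ex 0 = 0.
Proof. by apply: (addIr (ex 0)); rewrite -(lexD L) !add0r. Qed.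
Let ey0 : ey 0 = 0.
Proof. by apply: (addIr (ey 0)); rewrite -(leyD L) !add0r. Qed.
Let ex_sum n (f : 'I_n -> M) : ex (\sum_i f i) = \sum_i ex (f i).
Proof. exact: (big_morph ex (lexD L) ex0). Qed.
Let ey_sum n (f : 'I_n -> M) : ey (\sum_i f i) = \sum_i ey (f i).
Proof. exact: (big_morph ey (leyD L) ey0). Qed.
Let sc_sum a n (f : 'I_n -> M) : sc a (\sum_i f i) = \sum_i sc a (f i).
Proof. exact: (big_morph (sc a) (lscDr L a) (scr0 a)). Qed.
Let exyiter j w : ex (iter j ey w) = iter j ey (ex w).
Proof. by elim: j => //= j IH; rewrite (lexyC L) IH. Qed.
Let eyxiter i w : ey (iter i ex w) = iter i ex (ey w).
Proof. by elim: i => //= j IH; rewrite -(lexyC L) IH. Qed.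
Let exiterD i : {morph iter i ex : w z / w + z}.
Proof. by elim: i => // i IH w z /=; rewrite IH (lexD L). Qed.
Let eyiterD i : {morph iter i ey : w z / w + z}.
Proof. by elim: i => // i IH w z /=; rewrite IH (leyD L). Qed.

Let g w a j := sc a (iter j ey w).
Let B u w := polysum (g w) u.
Let h w u i := B u (iter i ex w).
Let E p w := lpdo_eval sc ex ey p w.

Let g0 w j : g w 0 j = 0. Proof. exact: sc0. Qed.
Let gD w j : {morph (g w)^~ j : a b / a + b}.
Proof. by move=> a b; apply: (lscDl L). Qed.
Let BD w : {morph B^~ w : u v / u + v}.
Proof. by move=> u v; apply: polysumD. Qed.
Let h0 w i : h w 0 i = 0. Proof. exact: polysum0. Qed.
Let hD w i : {morph (h w)^~ i : a b / a + b}.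
Proof. by move=> a b; apply: BD. Qed.

Let exiteryC i j w : iter i ex (iter j ey w) = iter j ey (iter i ex w).
Proof. by elim: i => //= i ->; rewrite exyiter. Qed.

Let EE p w : E p w = polysum (h w) p.
Proof.
apply: eq_bigr => i _; apply: eq_bigr => j _.
by rewrite /g exiteryC.
Qed.

Let B_sc a u w : B (a%:P * u) w = sc a (B u w).
Proof.
rewrite /B (@polysum_widen _ _ _ _ (size u)) //; last first.
  by rewrite mul_polyC size_scale_leq.
by rewrite sc_sum; apply: eq_bigr => j _; rewrite coefCM /g (lscA L).
Qed.

Let B_dx u w : ex (B u w) = B (map_poly dx u) w + B u (ex w).
Proof.
rewrite /B polysum_map ?raddf0 // -polysum_split ex_sum.
by apply: eq_bigr => j _; rewrite /g (lexZ L) exyiter.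
Qed.

Let B_dy u w : ey (B u w) = B (map_poly dy u) w + B (u * 'X) w.
Proof.
rewrite /B polysum_map ?raddf0 // polysumMX // -polysum_split ey_sum.
by apply: eq_bigr => j _; rewrite /g (leyZ L).
Qed.

Lemma lpdo_evalDl p q w :
  lpdo_eval sc ex ey (p + q) w = lpdo_eval sc ex ey p w + lpdo_eval sc ex ey q w.
Proof. by rewrite -!/(E _ _) !EE polysumD. Qed.

Lemma lpdo_evalDr p w z :
  lpdo_eval sc ex ey p (w + z) = lpdo_eval sc ex ey p w + lpdo_eval sc ex ey p z.
Proof.
rewrite /lpdo_eval -big_split; apply: eq_bigr => i _ /=.
rewrite -big_split; apply: eq_bigr => j _ /=.
by rewrite eyiterD exiterD (lscDr L).
Qed.

Lemma lpdo_eval0l w : lpdo_eval sc ex ey 0 w = 0.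
Proof. by rewrite -/(E _ _) EE polysum0. Qed.

Lemma lpdo_evalC a w : lpdo_eval sc ex ey (a%:P%:P : {poly {poly F}}) w = sc a w.
Proof. by rewrite -/(E _ _) EE polysumC // /h /B polysumC. Qed.

Lemma lpdo_eval_scale a p w :
  lpdo_eval sc ex ey (lpdo_scale a p) w = sc a (lpdo_eval sc ex ey p w).
Proof.
rewrite -!/(E _ _) !EE (@polysum_widen _ _ _ _ (size p)) ?size_scale_leq //.
by rewrite sc_sum; apply: eq_bigr => i _; rewrite coefZ /h B_sc.
Qed.

Lemma lpdo_eval_dx p w :
  lpdo_eval sc ex ey (lpdo_dx p) w = ex (lpdo_eval sc ex ey p w).
Proof.
rewrite -!/(E _ _) !EE polysumD // polysumMX // polysum_map ?map_poly0 //.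
rewrite -polysum_split ex_sum; apply: eq_bigr => i _.
by rewrite /h B_dx addrC.
Qed.

Lemma lpdo_eval_dy p w :
  lpdo_eval sc ex ey (lpdo_dy p) w = ey (lpdo_eval sc ex ey p w).
Proof.
rewrite -!/(E _ _) !EE polysumD // polysum_map ?map_poly0 //.
rewrite (@polysum_widen _ _ _ ('X *: _) (size p)) ?size_scale_leq //.
rewrite -big_split ey_sum; apply: eq_bigr => i _.
by rewrite /h coefZ B_dy addrC mulrC.
Qed.

Lemma lpdo_evalM p q w :
  lpdo_eval sc ex ey (lpdo_mul p q) w =
  lpdo_eval sc ex ey p (lpdo_eval sc ex ey q w).
Proof.
have Dsum n (f : 'I_n -> lpdo F) : lpdo_eval sc ex ey (\sum_i f i) w =
    \sum_i lpdo_eval sc ex ey (f i) w.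
  apply: (big_morph (fun p => lpdo_eval sc ex ey p w) _ (lpdo_eval0l w)).
  by move=> *; rewrite lpdo_evalDl.
have iterE k l : lpdo_eval sc ex ey
      (iter k (@lpdo_dx F) (iter l (@lpdo_dy F) q)) w =
    iter k ex (iter l ey (lpdo_eval sc ex ey q w)).
  elim: k => [|k IH] /=; last by rewrite lpdo_eval_dx IH.
  by elim: l => //= l IH; rewrite lpdo_eval_dy IH.
rewrite /lpdo_mul {1}/(lpdo_eval (@lpdo_scale F)) Dsum.
apply: eq_bigr => i _; rewrite Dsum; apply: eq_bigr => j _.
rewrite lpdo_eval_scale; congr (sc _ _).
exact: iterE.
Qed.

End LpdoEvalTheory.

Section LpdoRing.
Variable F : pdiffFieldType.
Implicit Types p q r : lpdo F.

Lemma map_poly_leibniz (R : nzRingType) (d : {additive R -> R}) (u v : {poly R}) :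
  (forall a b, d (a * b) = d a * b + a * d b) ->
  map_poly d (u * v) = map_poly d u * v + u * map_poly d v.
Proof.
move=> dM; apply/polyP => n; rewrite coefD !coefM coef_map /= coefM raddf_sum.
by rewrite -big_split; apply: eq_bigr => i _; rewrite !coef_map dM.
Qed.

Lemma map_polyXC (R : nzRingType) (d : {additive R -> R}) (u : {poly R}) :
  map_poly d (u * 'X) = map_poly d u * 'X.
Proof.
apply/polyP => i; rewrite coef_map !coefMX; case: eqP => _ /=; first exact: raddf0.
by rewrite coef_map.
Qed.

Lemma lpdo_leibniz : leibniz_action (@lpdo_scale F) (@lpdo_dx F) (@lpdo_dy F).
Proof.
have C (d : {additive F -> F}) a : map_poly d a%:P = (d a)%:P.
  by apply/polyP => i; rewrite coef_map !coefC; case: eqP => //= _; exact: raddf0.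
have CM (d : {additive F -> F}) a p : (forall a b, d (a * b) = d a * b + a * d b) ->
    map_poly (map_poly d) (lpdo_scale a p) =
    lpdo_scale (d a) p + lpdo_scale a (map_poly (map_poly d) p : {poly {poly F}}).
  move=> dM; apply/polyP => i; rewrite coefD !coefZ !coef_map /= coefZ.
  by rewrite map_poly_leibniz // C.
split.
- by move=> a b p; rewrite /lpdo_scale scalerA polyCM.
- by move=> p; rewrite /lpdo_scale scale1r.
- by move=> p a b; rewrite /lpdo_scale polyCD scalerDl.
- by move=> a p q; rewrite /lpdo_scale scalerDr.
- by move=> p q; rewrite /lpdo_dx mulrDl raddfD addrACA.
- by move=> p q; rewrite /lpdo_dy scalerDr raddfD addrACA.
- move=> a p; rewrite /lpdo_dx CM; last exact: dxM.
  by rewrite /lpdo_scale scalerDr scalerAl addrCA.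
- move=> a p; rewrite /lpdo_dy CM; last exact: dyM.
  by rewrite /lpdo_scale scalerDr !scalerA mulrC addrCA.
have XM (d : {additive F -> F}) (p : {poly {poly F}}) :
    map_poly (map_poly d) ('X *: p) = 'X *: map_poly (map_poly d) p.
  apply/polyP => i; rewrite coefZ !coef_map /= coefZ.
  by rewrite mulrC map_polyXC mulrC.
have C2 (p : {poly {poly F}}) : map_poly (map_poly dx) (map_poly (map_poly dy) p) =
    map_poly (map_poly dy) (map_poly (map_poly dx) p).
  apply/polyP => i; rewrite !coef_map /=; apply/polyP => j.
  by rewrite !coef_map /= dxdyC.
move=> p; rewrite /lpdo_dx /lpdo_dy mulrDl scalerDr !raddfD /= XM C2.
by rewrite map_polyXC -scalerAl !addrA; congr (_ + _); rewrite addrAC.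
Qed.

Definition lpdo_one : lpdo F := (1 : {poly {poly F}}).

Lemma lpdo_mulA : associative (@lpdo_mul F).
Proof. by move=> p q r; rewrite {3}/lpdo_mul (lpdo_evalM lpdo_leibniz). Qed.

Lemma lpdo_mul1p : left_id lpdo_one (@lpdo_mul F).
Proof.
move=> p; rewrite -[lpdo_one]/((1 : F)%:P%:P) /lpdo_mul (lpdo_evalC lpdo_leibniz).
exact: (lsc1 lpdo_leibniz).
Qed.

Lemma lpdo_iter1 i j :
  iter i (@lpdo_dx F) (iter j (@lpdo_dy F) lpdo_one) =
  ('X^j *: 'X^i : {poly {poly F}}).
Proof.
have d1 (d : {additive F -> F}) l : d 1 = 0 -> map_poly d 'X^l = 0.
  move=> d1; apply/polyP => m; rewrite coef_map coefXn coef0 /=.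
  by case: eqP => _; rewrite ?raddf0.
have dx1 l : map_poly (@dx F) 'X^l = 0 by apply: d1; apply: derivation1 (@dxM F).
have dy1 l : map_poly (@dy F) 'X^l = 0 by apply: d1; apply: derivation1 (@dyM F).
elim: i => [|i IH] /=.
  elim: j => [|j IH] /=; first by rewrite !expr0 scale1r.
  rewrite IH /lpdo_dy scalerA -exprS expr0 -[RHS]addr0; congr (_ + _).
  apply/polyP => m; rewrite coef_map /= coefZ coef1 coef0.
  by case: eqP => _; rewrite ?mulr1 ?mulr0 ?dy1 ?raddf0.
rewrite IH /lpdo_dx -scalerAl -exprSr -[RHS]addr0; congr (_ + _).
apply/polyP => m; rewrite coef_map /= coefZ coefXn coef0.
by case: eqP => _; rewrite ?mulr1 ?mulr0 ?dx1 ?raddf0.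
Qed.

Lemma lpdo_mulp1 : right_id lpdo_one (@lpdo_mul F).
Proof.
move=> p; rewrite [RHS](_ : _ = \poly_(i < size p) p`_i); last by rewrite coefK.
rewrite poly_def; apply: eq_bigr => i _.
rewrite -[p`_i in RHS]coefK poly_def scaler_suml; apply: eq_bigr => j _.
by rewrite lpdo_iter1 /lpdo_scale scalerA mul_polyC.
Qed.

Lemma lpdo_mulDl : left_distributive (@lpdo_mul F) +%R.
Proof. by move=> p q r; exact: (lpdo_evalDl lpdo_leibniz). Qed.

Lemma lpdo_mulDr : right_distributive (@lpdo_mul F) +%R.
Proof. by move=> p q r; exact: (lpdo_evalDr lpdo_leibniz). Qed.

Lemma lpdo_one_neq0 : lpdo_one != 0.
Proof. exact: (oner_neq0 {poly {poly F}}). Qed.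

HB.instance Definition _ := GRing.Zmodule_isNzRing.Build (lpdo F)
  lpdo_mulA lpdo_mul1p lpdo_mulp1 lpdo_mulDl lpdo_mulDr lpdo_one_neq0.

Definition lpdoC (a : F) : lpdo F := (a%:P%:P : {poly {poly F}}).

Lemma lpdoCE a p : lpdoC a * p = lpdo_scale a p.
Proof. exact: (lpdo_evalC lpdo_leibniz). Qed.

Lemma lpdoCM a b : lpdoC (a * b) = lpdoC a * lpdoC b.
Proof. by rewrite lpdoCE /lpdo_scale /lpdoC !polyCM mul_polyC. Qed.

Lemma lpdoCD a b : lpdoC (a + b) = lpdoC a + lpdoC b.
Proof. by rewrite /lpdoC !polyCD. Qed.

Lemma lpdoC1 : lpdoC 1 = 1. Proof. by []. Qed.

Lemma lpdoC_central (c : constants F) p : lpdoC (val c) * p = p * lpdoC (val c).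
Proof.
have cx q : lpdo_dx (lpdo_scale (val c) q) = lpdo_scale (val c) (lpdo_dx q).
  rewrite (lexZ lpdo_leibniz) dx_const.
  by rewrite {1}/lpdo_scale scale0r add0r.
have cy q : lpdo_dy (lpdo_scale (val c) q) = lpdo_scale (val c) (lpdo_dy q).
  rewrite (leyZ lpdo_leibniz) dy_const.
  by rewrite {1}/lpdo_scale scale0r add0r.
have c0 : lpdo_scale (val c) 0 = 0 :> lpdo F by rewrite /lpdo_scale scaler0.
have cD := lscDr lpdo_leibniz (val c).
have iterc k l q : lpdo_scale (val c) (iter k (@lpdo_dx F) (iter l (@lpdo_dy F) q)) =
    iter k (@lpdo_dx F) (iter l (@lpdo_dy F) (lpdo_scale (val c) q)).
  elim: k => [|k IH] /=; last by rewrite -IH cx.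
  by elim: l => //= l IH; rewrite -IH cy.
rewrite -[lpdoC _ in RHS]mulr1 !lpdoCE -{1}[p]mulr1.
rewrite -![_ * _]/(lpdo_eval _ _ _ _ _) /lpdo_eval.
rewrite (big_morph _ cD c0); apply: eq_bigr => i _.
rewrite (big_morph _ cD c0); apply: eq_bigr => j _.
rewrite !(lscA lpdo_leibniz) mulrC -(lscA lpdo_leibniz); congr lpdo_scale.
exact: iterc.
Qed.

End LpdoRing.

Definition left_ideal (F : pdiffFieldType) (J : set (lpdo F)) :=
  [/\ J 0, forall p q, J p -> J q -> J (p + q) & forall p q, J q -> J (p * q)].

Definition left_ideal_gen (F : pdiffFieldType) (t : nat) (p : 'I_t -> lpdo F) :
    set (lpdo F) :=
  [set r | exists q : 'I_t -> lpdo F, r = \sum_i q i * p i].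

Definition Syz (F : pdiffFieldType) (t : nat) (J : set (lpdo F))
    (p : 'I_t -> lpdo F) : set {ffun 'I_t -> lpdo F} :=
  [set q | J (\sum_i q i * p i)].

Definition order_le (F : pdiffFieldType) (z : nat) : set (lpdo F) :=
  [set p | forall i j, (z < i + j)%N -> (p : {poly {poly F}})`_i`_j = 0].

(* The operators [e i] represent an [F]-basis of the space of operators of
   order at most [z] modulo those lying in [J]. *)
Definition dim_modulo (F : pdiffFieldType) (J : set (lpdo F)) (z n : nat) :=
  exists e : 'I_n -> lpdo F,
    [/\ forall i, order_le z (e i),
        forall a : 'I_n -> F, J (\sum_i lpdoC (a i) * e i) -> forall i, a i = 0
      & forall p, order_le z p ->
          exists a : 'I_n -> F, J (p - \sum_i lpdoC (a i) * e i)].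

(* [P] is the Hilbert-Kolchin polynomial; its degree is [(size P).-1]. *)
Definition differential_type (F : pdiffFieldType) (J : set (lpdo F)) (d : nat) :=
  exists2 P : {poly rat}, size P = d.+1 &
    exists z0 : nat, forall z, (z0 <= z)%N ->
      exists2 n, dim_modulo J z n & P.[z%:R] = n%:R.

Section Subspace.
Variables (V : choiceType) (S : {pred V}).

Record subspace := Subspace { subspace_val : V; _ : subspace_val \in S }.

HB.instance Definition _ := [isSub for subspace_val].
HB.instance Definition _ := [Choice of subspace by <:].

End Subspace.

HB.instance Definition _ (K : pzRingType) (V : lmodType K) (S : submodClosed V) :=
  [SubChoice_isSubLmodule of subspace S by <:].

Section Quotient.
Variables (K : pzRingType) (V : lmodType K) (W : submodClosed V).
Local Open Scope quotient_scope.

(* [W] with its structure of subgroup, which [submodClosed] does not record. *)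
Definition zmod_pred : {pred V} := fun v => v \in W.

Lemma zmod_pred_closed : zmod_closed zmod_pred.
Proof. exact: (GRing.submod_closedB (submodClosedP W)). Qed.

HB.instance Definition _ := GRing.isZmodClosed.Build V zmod_pred zmod_pred_closed.

Definition lquot : Type := Quotient.quot zmod_pred.

HB.instance Definition _ := GRing.Zmodule.copy lquot (Quotient.quot zmod_pred).

Definition lquot_pi (v : V) : lquot := \pi_(Quotient.quot zmod_pred) v.
Definition lquot_scale (a : K) (x : lquot) : lquot :=
  lquot_pi (a *: repr (x : Quotient.quot zmod_pred)).

Lemma lquot_piE u v : (lquot_pi u == lquot_pi v) = (u - v \in W).
Proof. by rewrite -[RHS]/(u - v \in zmod_pred) Quotient.idealrBE. Qed.

Lemma lquot_pi_surj x : exists v, x = lquot_pi v.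
Proof. by exists (repr (x : Quotient.quot zmod_pred)); rewrite /lquot_pi reprK. Qed.

Lemma lquot_piD : {morph lquot_pi : u v / u + v}.
Proof. by move=> u v; exact: (Quotient.pi_add zmod_pred). Qed.

Lemma lquot_piZ a v : lquot_scale a (lquot_pi v) = lquot_pi (a *: v).
Proof.
apply/eqP; rewrite lquot_piE -scalerBr rpredZ // -lquot_piE.
by rewrite {1}/lquot_pi reprK.
Qed.

Lemma lquot_scaleA a b x : lquot_scale a (lquot_scale b x) = lquot_scale (a * b) x.
Proof. by have [v ->] := lquot_pi_surj x; rewrite !lquot_piZ scalerA. Qed.
Lemma lquot_scale1 : left_id 1 lquot_scale.
Proof. by move=> x; have [v ->] := lquot_pi_surj x; rewrite lquot_piZ scale1r. Qed.
Lemma lquot_scaleDr : right_distributive lquot_scale +%R.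
Proof.
move=> a x y; have [u ->] := lquot_pi_surj x; have [v ->] := lquot_pi_surj y.
by rewrite -lquot_piD !lquot_piZ -lquot_piD scalerDr.
Qed.
Lemma lquot_scaleDl x : {morph lquot_scale^~ x : a b / a + b}.
Proof.
by move=> a b; have [v ->] := lquot_pi_surj x; rewrite !lquot_piZ -lquot_piD scalerDl.
Qed.

HB.instance Definition _ := GRing.Zmodule_isLmodule.Build K lquot
  lquot_scaleA lquot_scale1 lquot_scaleDr lquot_scaleDl.

End Quotient.

Section SubspaceQuotient.
Variables (K : pzRingType) (V : lmodType K) (S W : submodClosed V).

Definition in_subspace : {pred subspace S} := [pred v | val v \in W].

Lemma in_subspace_submod : submod_closed in_subspace.
Proof.
split=> [|a u v]; rewrite !inE ?raddf0 ?rpred0 // => uW vW.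
by rewrite linearP rpredD ?rpredZ.
Qed.

HB.instance Definition _ := GRing.isSubmodClosed.Build K (subspace S) in_subspace
  (GRing.submod_closed_semi in_subspace_submod).

End SubspaceQuotient.
Arguments in_subspace {K V} S W.

(* S / W, for subspaces W <= S of a common space (in general S / (S /\ W)). *)
Definition subspace_quotient (K : pzRingType) (V : lmodType K)
    (S W : submodClosed V) : lmodType K := lquot (in_subspace S W).

Definition isomorphic (K : pzRingType) (U V : lmodType K) :=
  exists h : {linear U -> V}, bijective h.

(* A left F[dx, dy]-module seen as a vector space over the constants: an alias is
   needed, as these act through their (central) image in F[dx, dy]. *)
Definition resC (F : pdiffFieldType) (V : lmodType (lpdo F)) : Type := V.

Section RestrictScalars.
Variables (F : pdiffFieldType) (V : lmodType (lpdo F)).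

HB.instance Definition _ := GRing.Zmodule.copy (resC V) V.

Definition resC_scale (c : constants F) (v : resC V) : resC V :=
  lpdoC (val c) *: (v : V).

Lemma resC_scaleA a b v : resC_scale a (resC_scale b v) = resC_scale (a * b) v.
Proof. by rewrite /resC_scale scalerA -lpdoCM. Qed.
Lemma resC_scale1 : left_id 1 resC_scale.
Proof. by move=> v; rewrite /resC_scale [lpdoC _]lpdoC1 scale1r. Qed.
Lemma resC_scaleDr : right_distributive resC_scale +%R.
Proof. by move=> c u v; rewrite /resC_scale scalerDr. Qed.
Lemma resC_scaleDl v : {morph resC_scale^~ v : a b / a + b}.
Proof. by move=> a b; rewrite /resC_scale lpdoCD scalerDl. Qed.

HB.instance Definition _ := GRing.Zmodule_isLmodule.Build (constants F) (resC V)
  resC_scaleA resC_scale1 resC_scaleDr resC_scaleDl.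

End RestrictScalars.

Section Solutions.
Variables (F : pdiffFieldType) (V : lmodType (lpdo F)).

Definition solutions (I : set (lpdo F)) : {pred resC V} :=
  fun w => `[< forall p, I p -> p *: (w : V) = 0 >].

Lemma solutions_submod I : submod_closed (solutions I).
Proof.
split=> [|c u v]; first by apply/asboolP => p _; rewrite scaler0.
move=> /asboolP uI /asboolP vI; apply/asboolP => p Ip.
rewrite scalerDr (vI p Ip) addr0 [_ *: u]/(resC_scale c u) /resC_scale.
by rewrite scalerA -lpdoC_central -scalerA (uI p Ip) scaler0.
Qed.

HB.instance Definition _ I := GRing.isSubmodClosed.Build (constants F) (resC V)
  (solutions I) (GRing.submod_closed_semi (solutions_submod I)).

Definition sys_solutions (t : nat) (S : set {ffun 'I_t -> lpdo F}) :
    {pred resC {ffun 'I_t -> V}} :=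
  fun w => `[< forall q, S q -> \sum_i q i *: (w : {ffun 'I_t -> V}) i = 0 >].

Lemma sys_solutions_submod t (S : set {ffun 'I_t -> lpdo F}) :
  submod_closed (sys_solutions S).
Proof.
split=> [|c u v].
  by apply/asboolP => q _; rewrite big1 // => i _; rewrite ffunE scaler0.
move=> /asboolP uS /asboolP vS; apply/asboolP => q Sq.
transitivity (lpdoC (val c) *: (\sum_i q i *: (u : {ffun 'I_t -> V}) i) +
              \sum_i q i *: (v : {ffun 'I_t -> V}) i); last first.
  by rewrite (uS q Sq) (vS q Sq) scaler0 addr0.
rewrite scaler_sumr -big_split; apply: eq_bigr => i _ /=.
by rewrite !ffunE scalerDr !scalerA lpdoC_central.
Qed.

HB.instance Definition _ t (S : set {ffun 'I_t -> lpdo F}) :=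
  GRing.isSubmodClosed.Build (constants F) (resC {ffun 'I_t -> V})
    (sys_solutions S) (GRing.submod_closed_semi (sys_solutions_submod S)).

End Solutions.
Arguments solutions {F} V I.
Arguments sys_solutions {F} V {t} S.

Section FracSeries.
Variables (F : pdiffFieldType) (k : nat) (s : 'I_k -> rat) (f : 'I_k -> F).

Definition common_denom : nat := \big[lcmn/1%N]_(i < k) `|denq (s i)|%N.

(* The formal series sum_r (H r) G^{(r)} is stored as its family of
   coefficients [H], the symbols G^{(r)}, r in Q, being formal and linearly
   independent.  The series of the form sum_(i >= 0) h_i G^{(s0 - i / q)} are
   those whose support lies in {s0 - i / q : i >= 0}. *)
Definition frac_series : {pred rat -> F} := fun H =>
  `[< exists2 s0 : rat, s0 * common_denom%:R \is a Num.int &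
      forall r, H r != 0 -> exists i : nat, r = s0 - i%:R / common_denom%:R >].

Definition series_scale (a : F) (H : rat -> F) : rat -> F := fun r => a * H r.

(* Leibniz rule, with d G^{(r)} = sum_j (d f_j) G^{(s_j + r)}. *)
Definition series_der (d : F -> F) (H : rat -> F) : rat -> F := fun r =>
  d (H r) + \sum_(j < k) d (f j) * H (r - s j).

Local Notation q := common_denom.

Lemma common_denom_gt0 : (0 < q)%N.
Proof.
rewrite /q; elim/big_ind: _ => // [m n m0 n0|i _]; first by rewrite lcmn_gt0 m0.
by rewrite absz_gt0 denq_neq0.
Qed.

Let q0 : (q%:R : rat) != 0.
Proof. by rewrite pnatr_eq0 -lt0n common_denom_gt0. Qed.
Let qgt0 : 0 < (q%:R : rat).
Proof. by rewrite ltr0n common_denom_gt0. Qed.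

Lemma common_denom_int j : s j * q%:R \is a Num.int.
Proof.
have /dvdnP[m qE] : (`|denq (s j)| %| q)%N.
  by rewrite /q (bigD1 j) //= dvdn_lcml.
rewrite qE mulnC natrM mulrA.
have -> : (`|denq (s j)|%N%:R : rat) = (denq (s j))%:~R.
  by rewrite -[LHS]/((`|denq (s j)|%N : int)%:~R) absz_denq.
by rewrite -{1}[s j]divq_num_den divfK ?intr_eq0 ?denq_neq0 // rpredM ?intr_int ?natr_int.
Qed.

Lemma frac_seriesP H : reflect
  ((forall r, H r != 0 -> r * q%:R \is a Num.int) /\
   exists b : rat, forall r, H r != 0 -> r <= b)
  (H \in frac_series).
Proof.
apply: (iffP (asboolP _)) => [[s0 s0q Hs]|[Hint [b Hb]]].
  split=> [r /Hs[i ->]|]; first by rewrite mulrBl divfK // rpredB ?natr_int.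
  exists s0 => r /Hs[i ->]; rewrite gerBl divr_ge0 ?ler0n //.
exists ((Num.ceil (b * q%:R))%:~R / q%:R); first by rewrite divfK // intr_int.
move=> r Hr; have /intrP[m rm] := Hint r Hr.
have mN : m <= Num.ceil (b * q%:R).
  rewrite -(ler_int rat) -rm (le_trans _ (ceil_ge _)) //.
  by rewrite ler_pM2r // Hb.
exists `|Num.ceil (b * q%:R) - m|%N.
have -> : (`|Num.ceil (b * q%:R) - m|%N%:R : rat) = (Num.ceil (b * q%:R) - m)%:~R.
  by rewrite -[LHS]/((`|Num.ceil (b * q%:R) - m|%N : int)%:~R) gez0_abs ?subr_ge0.
by rewrite rmorphB /= -rm mulrBl mulfK // opprB addrC subrK.
Qed.

Lemma frac_series_zmod : zmod_closed frac_series.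
Proof.
split=> [|H K /frac_seriesP[HZ [b Hb]] /frac_seriesP[KZ [c Kc]]].
  by apply/frac_seriesP; split=> [r|]; [|exists 0 => r]; rewrite eqxx.
have HK r : (H - K) r != 0 -> H r != 0 \/ K r != 0.
  rewrite -[(H - K) r]/(H r - K r); have [->|] := eqVneq (H r) 0; last by left.
  by rewrite sub0r oppr_eq0; right.
apply/frac_seriesP; split=> [r /HK[/HZ|/KZ]|] //.
by exists (Num.max b c) => r /HK[/Hb|/Kc] le; rewrite le_max le ?orbT.
Qed.

HB.instance Definition _ := GRing.isZmodClosed.Build (rat -> F) frac_series
  frac_series_zmod.

Lemma frac_series_scale a H : H \in frac_series -> series_scale a H \in frac_series.
Proof.
move=> /frac_seriesP[HZ [b Hb]].
have aH r : series_scale a H r != 0 -> H r != 0 by rewrite mulf_eq0 => /norP[].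
by apply/frac_seriesP; split=> [r /aH/HZ|] //; exists b => r /aH/Hb.
Qed.

Lemma frac_series_der (d : {additive F -> F}) H :
  H \in frac_series -> series_der d H \in frac_series.
Proof.
move=> /frac_seriesP[HZ [b Hb]].
have dH r : series_der d H r != 0 -> H r != 0 \/ exists j, H (r - s j) != 0.
  move=> dHr; have [Hr|] := eqVneq (H r) 0; last by left.
  right; apply: contrapT => H0; move/negP: dHr; apply; apply/eqP.
  rewrite /series_der Hr raddf0 add0r big1 // => j _.
  have [->|Hj] := eqVneq (H (r - s j)) 0; first by rewrite mulr0.
  by case: H0; exists j.
apply/frac_seriesP; split=> [r /dH[/HZ//|[j /HZ]]|].
  by move=> rj; rewrite -[r](subrK (s j)) mulrDl rpredD ?common_denom_int.
exists (b + \sum_j `|s j|) => r /dH[/Hb rb|[j /Hb rb]].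
  by rewrite (le_trans rb) // lerDl sumr_ge0.
rewrite -[r](subrK (s j)) lerD // (le_trans (ler_norm _)) //.
by rewrite (bigD1 j) //= lerDl sumr_ge0.
Qed.

Record frac_ser := FracSer { series_coef :> rat -> F; _ : series_coef \in frac_series }.

HB.instance Definition _ := [isSub for series_coef].
HB.instance Definition _ := [Choice of frac_ser by <:].
HB.instance Definition _ := [SubChoice_isSubZmodule of frac_ser by <:].

(* The group of series does not depend on [f], but the action of dx, dy does. *)
Definition VG_of (_ : 'I_k -> F) : Type := frac_ser.
Local Notation VG := (VG_of f).

HB.instance Definition _ := GRing.Zmodule.copy VG frac_ser.

Definition VG_scale (a : F) (H : VG) : VG :=
  FracSer (frac_series_scale a (valP (H : frac_ser))).
Definition VG_dx (H : VG) : VG := FracSer (frac_series_der dx (valP (H : frac_ser))).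
Definition VG_dy (H : VG) : VG := FracSer (frac_series_der dy (valP (H : frac_ser))).

Lemma VG_ext (H K : VG) : series_coef H =1 series_coef K -> H = K.
Proof. by move=> HK; apply/val_inj/funext. Qed.

Lemma series_derD (d : {additive F -> F}) (H K : frac_ser) r :
  series_der d (H + K) r = series_der d H r + series_der d K r.
Proof.
have HK x : (H + K) x = H x + K x by [].
rewrite /series_der HK raddfD addrACA; congr (_ + _).
by rewrite -big_split; apply: eq_bigr => j _; rewrite HK mulrDr.
Qed.

Lemma series_derZ (d : {additive F -> F}) a H r :
  (forall a b, d (a * b) = d a * b + a * d b) ->
  series_der d (series_scale a H) r = d a * H r + a * series_der d H r.
Proof.
move=> dM; rewrite /series_der /series_scale dM -addrA mulrDr mulr_sumr.
by congr (_ + (_ + _)); apply: eq_bigr => j _; rewrite mulrCA.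
Qed.

Lemma VG_leibniz : leibniz_action VG_scale VG_dx VG_dy.
Proof.
split.
- by move=> a b H; apply: VG_ext => r; exact: mulrA.
- by move=> H; apply: VG_ext => r; exact: mul1r.
- by move=> H a b; apply: VG_ext => r; exact: mulrDl.
- by move=> a H K; apply: VG_ext => r; exact: mulrDr.
- by move=> H K; apply: VG_ext => r; exact: series_derD.
- by move=> H K; apply: VG_ext => r; exact: series_derD.
- by move=> a H; apply: VG_ext => r; apply: series_derZ; exact: dxM.
- by move=> a H; apply: VG_ext => r; apply: series_derZ; exact: dyM.
move=> H; apply: VG_ext => r; rewrite /= /series_der.
rewrite !raddfD !raddf_sum /= dxdyC -!addrA; congr (_ + _).
have E (d e : {additive F -> F}) : (forall a b, d (a * b) = d a * b + a * d b) ->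
    \sum_j d (e (f j) * H (r - s j)) +
    \sum_j d (f j) * (e (H (r - s j)) + \sum_i e (f i) * H (r - s j - s i)) =
    \sum_j d (e (f j)) * H (r - s j) +
    (\sum_j (e (f j) * d (H (r - s j)) + d (f j) * e (H (r - s j))) +
     \sum_j \sum_i d (f j) * e (f i) * H (r - s j - s i)).
  move=> dM; rewrite -!big_split /=; apply: eq_bigr => j _.
  rewrite dM mulrDr -!addrA; congr (_ + (_ + (_ + _))).
  by rewrite mulr_sumr; apply: eq_bigr => i _; rewrite mulrA.
rewrite !E; [|exact: dyM|exact: dxM]; congr (_ + (_ + _)).
- by apply: eq_bigr => j _; rewrite /= dxdyC.
- by apply: eq_bigr => j _; rewrite /= addrC.
rewrite exchange_big; apply: eq_bigr => j _; apply: eq_bigr => i _.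
by rewrite /= [dx _ * _]mulrC -!addrA [- s i - _]addrC.
Qed.

Definition VG_act (p : lpdo F) (H : VG) : VG := lpdo_eval VG_scale VG_dx VG_dy p H.

Lemma VG_actA p r H : VG_act p (VG_act r H) = VG_act (p * r) H.
Proof. by rewrite /VG_act -(lpdo_evalM VG_leibniz). Qed.
Lemma VG_act1 : left_id 1 VG_act.
Proof.
by move=> H; rewrite /VG_act (lpdo_evalC VG_leibniz 1) (lsc1 VG_leibniz).
Qed.
Lemma VG_actDr : right_distributive VG_act +%R.
Proof. by move=> p H K; exact: (lpdo_evalDr VG_leibniz). Qed.
Lemma VG_actDl H : {morph VG_act^~ H : p r / p + r}.
Proof. by move=> p r; exact: (lpdo_evalDl VG_leibniz). Qed.

HB.instance Definition _ := GRing.Zmodule_isLmodule.Build (lpdo F) VG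
  VG_actA VG_act1 VG_actDr VG_actDl.

End FracSeries.
Notation VG := VG_of.

Section SolutionSpaces.
Variables (F : pdiffFieldType) (k : nat) (s : 'I_k -> rat) (f : 'I_k -> F).

Definition VG_sol (I : set (lpdo F)) : lmodType (constants F) :=
  subspace (solutions (VG s f) I).

Definition VG_sys_sol (t : nat) (S : set {ffun 'I_t -> lpdo F}) :
    lmodType (constants F) :=
  subspace (sys_solutions (VG s f) S).

Definition VG_sol_quotient (J J1 : set (lpdo F)) : lmodType (constants F) :=
  subspace_quotient (solutions (VG s f) J) (solutions (VG s f) J1).

End SolutionSpaces.

(* Main.v *)
(* The conclusion is that V_G is an injective F[dx, dy]-module: H |-> (p_i H)_i maps
   V_G(J) to V_G(Syz(J, J_1)) with kernel V_G(J_1), and it is onto because a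
   solution w of the syzygy system is a linear map J_1 -> V_G, p_i |-> w_i.

   F itself is injective.  A linear map psi : I -> F extends to an F-linear
   functional on F[dx, dy], that is, to a Taylor series over F solving the system
   a u = psi(a), a in I.  Taylor series form a domain with two commuting
   derivations that extends F, so the finitely many equations given by generators
   of I (F[dx, dy] is noetherian) are solvable in a differential extension field,
   hence in F.

   For V_G, let X shift exponents by 1/q.  Then dx - sum_j (dx f_j) X^(q s_j) acts
   on the coefficients alone, so a change of generators of F[dx, dy][X] turns V_G
   into F((1/X)) with the coefficientwise action and psi into a linear map Psi on a
   left ideal of F[dx, dy][X].  The leading coefficients in X form an ascending
   chain of left ideals; as it stabilizes, the exponents in Psi(Q) are bounded by
   b + deg(Q)/q.  Injectivity of F then yields the coefficients of the extending
   series one at a time, from the top. *)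
From HB Require Import structures.
Require Import Defs.
From mathcomp Require Import all_boot all_order all_algebra ring zify.
From mathcomp Require Import boolp classical_sets functions.

Set Implicit Arguments.
Unset Strict Implicit.
Unset Printing Implicit Defensive.

Import Order.TTheory GRing.Theory Num.Theory.

Local Open Scope ring_scope.
Local Open Scope classical_set_scope.

(** * Hilbert's basis theorem for Ore-type extensions *)

Section Noetherian.
Variable S : nzRingType.
Implicit Types (R I K : set S) (x r a : S).

Definition subring_set R :=
  [/\ R 1, forall a b, R a -> R b -> R (a - b)
    & forall a b, R a -> R b -> R (a * b)].

Definition submodule R K :=
  [/\ K 0, forall a b, K a -> K b -> K (a + b)
    & forall r a, R r -> K a -> K (r * a)].

(** Generation is expressed by minimality among submodules, so that a property stable under the
    module operations need only be checked on [g]. *)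
Definition generates R (g : seq S) I :=
  (forall a, a \in g -> I a) /\
  forall K, submodule R K -> (forall a, a \in g -> K a) -> I `<=` K.

Definition noetherian R :=
  forall I, I `<=` R -> submodule R I -> exists g, generates R g I.

(** These are the sums of r_i x^i over i < n, coefficients on the left. Such an expression need not
    be unique: this is a bound on the degree of some expression, and [x] may satisfy relations over
    [R]. *)
Fixpoint degree_lt R x n : set S :=
  if n is m.+1 then [set s | exists2 r, R r & degree_lt R x m (s - r * x ^+ m)]
  else [set 0].

Definition adjoin R x : set S := [set s | exists n, degree_lt R x n s].

Section Hilbert.
Variables (R : set S) (x : S).
Hypothesis Rring : subring_set R.
Hypothesis Rx : forall r, R r -> R (x * r - r * x).

Let R1 : R 1. Proof. by case: Rring. Qed.
Let R0 : R 0. Proof. by case: Rring => _ B _; rewrite -(subrr 1); apply: B. Qed.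
Let RM a b : R a -> R b -> R (a * b). Proof. by case: Rring => _ _; apply. Qed.
Let RN a : R a -> R (- a).
Proof. by case: Rring => _ B _ Ra; rewrite -sub0r; apply: B. Qed.
Let RD a b : R a -> R b -> R (a + b).
Proof.
by move=> Ra /RN Rb; case: Rring => _ B _; rewrite -[b]opprK; apply: B.
Qed.

Local Notation deg := (degree_lt R x).

Lemma degree_lt0 n : deg n 0.
Proof. by elim: n => //= n IH; exists 0; rewrite // mul0r subrr. Qed.

Lemma degree_ltD n a b : deg n a -> deg n b -> deg n (a + b).
Proof.
elim: n a b => [a b -> ->|n IH a b [r Rr ra] [u Ru ub]] /=; first by rewrite addr0.
by exists (r + u); [exact: RD | rewrite mulrDl opprD addrACA; exact: IH].
Qed.

Lemma degree_ltM n r a : R r -> deg n a -> deg n (r * a).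
Proof.
move=> Rr; elim: n a => [a ->|n IH a [u Ru ua]] /=; first by rewrite mulr0.
by exists (r * u); [exact: RM | rewrite -mulrA -mulrBr; exact: IH].
Qed.

Lemma degree_ltB n a b : deg n a -> deg n b -> deg n (a - b).
Proof.
move=> na nb; apply: degree_ltD => //; rewrite -mulN1r.
by apply: degree_ltM => //; exact: RN.
Qed.

Lemma degree_lt_widen n m a : (n <= m)%N -> deg n a -> deg m a.
Proof.
move=> /subnK <-; elim: (m - n)%N => // d IH /IH da; rewrite addSn /=.
by exists 0; rewrite // mul0r subr0.
Qed.

Lemma degree_lt_term n r : R r -> deg n.+1 (r * x ^+ n).
Proof. by move=> Rr; exists r; rewrite // subrr; exact: degree_lt0. Qed.

(** Moving [x] past a coefficient r costs only the commutator x r - r x, which lies in [R] by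
    hypothesis and contributes a term of degree n. *)
Lemma degree_ltX n a : deg n a -> deg n.+1 (x * a).
Proof.
elim: n a => [a ->|n IH a [r Rr ra]]; first by rewrite mulr0; exact: degree_lt0.
exists r => //; have -> : x * a - r * x ^+ n.+1 =
    x * (a - r * x ^+ n) + (x * r - r * x) * x ^+ n.
  by rewrite mulrBr mulrBl !mulrA addrA subrK exprS mulrA.
by apply: degree_ltD; [exact: IH | exact/degree_lt_term/Rx].
Qed.

Lemma degree_lt_lead n a r : R r -> deg n (a - r * x ^+ n) ->
  deg n.+1 (x * a - r * x ^+ n.+1).
Proof.
move=> Rr /degree_ltX ar.
have -> : x * a - r * x ^+ n.+1 =
    x * (a - r * x ^+ n) + (x * r - r * x) * x ^+ n.
  by rewrite mulrBr mulrBl !mulrA addrA subrK exprS mulrA.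
by apply: degree_ltD => //; exact/degree_lt_term/Rx.
Qed.

Lemma adjoinW a : R a -> adjoin R x a.
Proof. by move=> Ra; exists 1; exists a; rewrite // expr0 mulr1 subrr. Qed.

Lemma adjoin_gen : adjoin R x x.
Proof.
by exists 2; exists 1 => //; rewrite mul1r expr1 subrr; exact: degree_lt0.
Qed.

Lemma adjoin_subring : subring_set (adjoin R x).
Proof.
have ad a b : adjoin R x a -> adjoin R x b -> adjoin R x (a + b).
  move=> [n na] [m mb]; exists (maxn n m).
  by apply: degree_ltD; [move: na|move: mb]; apply: degree_lt_widen;
     rewrite ?leq_maxl ?leq_maxr.
have am r a : R r -> adjoin R x a -> adjoin R x (r * a).
  by move=> Rr [n na]; exists n; exact: degree_ltM.
split=> [|a b aR bR|a b [n]]; first exact: adjoinW.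
  by apply: ad => //; rewrite -mulN1r; apply: am => //; exact: RN.
(* Induction on the degree of the left factor; its top term r x^n acts on [b] by n multiplications
   by [x] and one by r. *)
elim: n a => [a -> bR|n IH a [r Rr ra] bR].
  by rewrite mul0r; apply: adjoinW.
rewrite -[a](subrK (r * x ^+ n)) mulrDl; apply: ad; first exact: IH.
rewrite -mulrA; apply: am => //; elim: (n) => [|k IHk]; first by rewrite mul1r.
by rewrite exprS -mulrA; case: IHk => m mb; exists m.+1; exact: degree_ltX.
Qed.

(* Hilbert's basis theorem for the Ore-type extension [R[x]]: compare, degree
   by degree, the left ideals of leading coefficients. *)
Lemma hilbert_basis : noetherian R -> noetherian (adjoin R x).
Proof.
move=> noethR I IR [I0 ID IM]; have [_ ad am] := adjoin_subring.
have IB a b : I a -> I b -> I (a - b).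
  move=> Ia Ib; apply: ID => //; rewrite -mulN1r; apply: IM => //.
  by apply/adjoinW/RN.
have IX a : I a -> I (x * a) by apply: IM; exact: adjoin_gen.
pose lead (K : set S) n : set S :=
  [set r | R r /\ exists2 a, K a & deg n (a - r * x ^+ n)].
have leadP K n : submodule (adjoin R x) K -> submodule R (lead K n).
  move=> [K0 KD KM]; split.
  - by split=> //; exists 0 => //; rewrite mul0r subrr; exact: degree_lt0.
  - move=> r u [Rr [a Ka ar]] [Ru [b Kb bu]]; split; first exact: RD.
    exists (a + b); first exact: KD.
    by rewrite mulrDl opprD addrACA; exact: degree_ltD.
  move=> r u Rr [Ru [b Kb bu]]; split; first exact: RM.
  exists (r * b); first by apply: KM => //; exact: adjoinW.
  by rewrite -mulrA -mulrBr; exact: degree_ltM.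
have leadS K n m : submodule (adjoin R x) K -> (n <= m)%N ->
    lead K n `<=` lead K m.
  move=> [K0 KD KM] /subnK <-; elim: (m - n)%N => // d IH r /IH [Rr [a Ka ar]].
  split=> //; exists (x * a); first by apply: KM => //; exact: adjoin_gen.
  exact: degree_lt_lead.
have IP : submodule (adjoin R x) I by [].
have leadI n : lead I n `<=` R by move=> r [].
pose L : set S := [set r | exists n, lead I n r].
have LP : submodule R L.
  split; first by exists 0%N; case: (leadP I 0%N IP).
    move=> r u [n nr] [m mu]; exists (maxn n m); case: (leadP I (maxn n m) IP).
    by move=> _ D _; apply: D; [move: nr|move: mu]; apply: leadS;
       rewrite ?leq_maxl ?leq_maxr.
  by move=> r u Rr [n nu]; exists n; case: (leadP I n IP) => _ _; apply.
have [g [gL Lg]] : exists g, generates R g L.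
  by apply: noethR => // r [n /leadI].
have [N gN] : exists N, forall a, a \in g -> lead I N a.
  elim: g gL {Lg} => [|a g IH] gL; first by exists 0%N.
  have [N gN] : exists N, forall a, a \in g -> lead I N a.
    by apply: IH => b bg; apply: gL; rewrite inE bg orbT.
  have [m am'] := gL a (mem_head _ _).
  exists (maxn m N) => b; rewrite inE => /predU1P[->|/gN].
    by apply: leadS am'; rewrite ?leq_maxl.
  by apply: leadS; rewrite ?leq_maxr.
have LN : L `<=` lead I N by apply: Lg => //; exact: leadP.
have /choice[lg lgP] n : exists g, generates R g (lead I n).
  by apply: noethR => //; exact: leadP.
have /choice[lift liftP] (nr : nat * S) : exists a, lead I nr.1 nr.2 ->
    I a /\ deg nr.1 (a - nr.2 * x ^+ nr.1).
  have [[Rr [a Ia ar]]|nI] := pselect (lead I nr.1 nr.2); last by exists 0.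
  by exists a.
(* The generators are lifts of generators of the leading ideals in degrees 0 to [N], from which on
   the chain is constant. *)
exists [seq lift (n, r) | n <- iota 0 N.+1, r <- lg n]; split.
  move=> _ /allpairsPdep[n [r [_ rg ->]]].
  by have [|] := liftP (n, r) => //; case: (lgP n) => h _; exact: h.
(* [K] is cut down to its part inside [I], so that subtracting an element with the same leading
   coefficient does not leave [I]. *)
move=> K KP Kg; have KIP : submodule (adjoin R x) (K `&` I).
  case: (KP) => K0 KD KM; split; first by split.
    by move=> a b [Ka Ia] [Kb Ib]; split; [exact: KD|exact: ID].
  by move=> r a Rr [Ka Ia]; split; [exact: KM|exact: IM].
have leadK n : lead I n `<=` lead (K `&` I) n.
  have leadK n' : (n' <= N)%N -> lead I n' `<=` lead (K `&` I) n'.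
    move=> nN; case: (lgP n') => gI; apply; first exact: leadP.
    move=> r rg; have [Rr _] := gI _ rg.
    have [|Ia ar] := liftP (n', r); first exact: gI.
    split=> //; exists (lift (n', r)) => //; split=> //; apply: Kg.
    by apply/allpairsPdep; exists n', r; rewrite mem_iota.
  have [/leadK//|/ltnW Nn] := leqP n N => r nr.
  by apply: (leadS _ N) => //; apply: leadK => //; apply: LN; exists n.
move=> a Ia; have [n] := IR a Ia.
elim: n a Ia => [a _ ->|n IH a Ia [r Rr ra]]; first by case: KP.
have [_ [b [Kb Ib] br]] : lead (K `&` I) n r.
  by apply: leadK; split=> //; exists a.
rewrite -[a](subrK b); case: (KP) => _ KD _; apply: KD => //.
apply: IH; first exact: IB.
by rewrite -[a](subrK (r * x ^+ n)) -addrA -[_ - b]opprB; exact: degree_ltB.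
Qed.

End Hilbert.
End Noetherian.

(** * Generators and noetherianity of F[dx, dy] *)

Section Operators.
Variable F : pdiffFieldType.
Implicit Types (a b : F) (p q : lpdo F).

Definition Dx : lpdo F := lpdo_dx 1.
Definition Dy : lpdo F := lpdo_dy 1.

Lemma lpdo_dxE p : lpdo_dx p = Dx * p.
Proof.
rewrite -[Dx * p]/(lpdo_eval _ _ _ _ _) (lpdo_eval_dx (lpdo_leibniz F)).
by congr lpdo_dx; rewrite -[LHS]mul1r.
Qed.

Lemma lpdo_dyE p : lpdo_dy p = Dy * p.
Proof.
rewrite -[Dy * p]/(lpdo_eval _ _ _ _ _) (lpdo_eval_dy (lpdo_leibniz F)).
by congr lpdo_dy; rewrite -[LHS]mul1r.
Qed.

(** Unfolding p * 1 displays p as a sum of terms a dx^i dy^j applied to 1. *)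
Lemma lpdo_ind (P : lpdo F -> Prop) : P 1 ->
  (forall p q, P p -> P q -> P (p + q)) ->
  (forall a p, P p -> P (lpdoC a * p)) ->
  (forall p, P p -> P (Dx * p)) -> (forall p, P p -> P (Dy * p)) ->
  forall p, P p.
Proof.
move=> P1 PD PZ Px Py p.
have P0 : P 0.
  rewrite -[0](_ : lpdoC 0 * 1 = _); first exact: PZ.
  by rewrite lpdoCE /lpdo_scale scale0r.
rewrite -[p]mulr1 -[p * 1]/(lpdo_eval _ _ _ _ _) /lpdo_eval.
apply: (big_ind P) => // i _; apply: (big_ind P) => // j _.
rewrite -lpdoCE; apply: PZ; move: (nat_of_ord i) (nat_of_ord j) => k l.
elim: k => [|k IH] /=; last by rewrite lpdo_dxE; exact: Px.
by elim: l => [|l IH] //=; rewrite lpdo_dyE; exact: Py.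
Qed.

Lemma lpdo_DxDy : Dx * Dy = Dy * Dx.
Proof. by rewrite -lpdo_dxE -lpdo_dyE (lexyC (lpdo_leibniz F)). Qed.

Lemma lpdo_DxC a : Dx * lpdoC a = lpdoC (dx a) + lpdoC a * Dx.
Proof.
rewrite -[lpdoC a]mulr1 !lpdoCE -lpdo_dxE (lexZ (lpdo_leibniz F)) -!lpdoCE.
by rewrite !mulr1.
Qed.

Lemma lpdo_DyC a : Dy * lpdoC a = lpdoC (dy a) + lpdoC a * Dy.
Proof.
rewrite -[lpdoC a]mulr1 !lpdoCE -lpdo_dyE (leyZ (lpdo_leibniz F)) -!lpdoCE.
by rewrite !mulr1.
Qed.

Lemma lpdoCB a b : lpdoC (a - b) = lpdoC a - lpdoC b.
Proof. by rewrite /lpdoC !polyCB. Qed.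

Lemma lpdoCN a : lpdoC (- a) = - lpdoC a.
Proof. by rewrite /lpdoC !polyCN. Qed.

(** The field F is noetherian, and the basis theorem is applied twice, adjoining first dy and then
    dx. *)
Lemma lpdo_noetherian (I : set (lpdo F)) : left_ideal I ->
  exists g, generates setT g I.
Proof.
pose R0 : set (lpdo F) := range (@lpdoC F).
have R0ring : subring_set R0.
  split; first by exists 1.
    by move=> _ _ [a _ <-] [b _ <-]; exists (a - b); rewrite // lpdoCB.
  by move=> _ _ [a _ <-] [b _ <-]; exists (a * b); rewrite // lpdoCM.
have R0y r : R0 r -> R0 (Dy * r - r * Dy).
  by move=> [a _ <-]; exists (dy a); rewrite // lpdo_DyC addrK.
have R0x r : R0 r -> R0 (Dx * r - r * Dx).
  by move=> [a _ <-]; exists (dx a); rewrite // lpdo_DxC addrK.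
have R0noeth : noetherian R0.
  move=> K KR [K0 KD KM].
  have [[a Ka a0]|K00] := pselect (exists2 a, K a & a != 0).
    have [b _ ba] := KR _ Ka; rewrite -ba in Ka a0.
    exists [:: lpdoC b]; split=> [c|L [L0 LD LM] Lg c Kc].
      by rewrite inE => /eqP->.
    have [d _ <-] := KR _ Kc.
    rewrite -[d](@divfK _ b); last by apply: contraNneq a0 => ->; rewrite /lpdoC !polyC0.
    by rewrite lpdoCM; apply: LM; [exists (d / b)|apply: Lg; rewrite mem_head].
  exists [::]; split=> // L [L0 _ _] _ c Kc.
  by have [->//|c0] := eqVneq c 0; case: K00; exists c.
set R1 := adjoin R0 Dy.
have R1ring : subring_set R1 by apply: adjoin_subring.
(* Since dx and dy commute, the commutator with [Dx] only differentiates coefficients and keeps the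
   degree in [Dy]. *)
have R1x r : R1 r -> R1 (Dx * r - r * Dx).
  move=> [n nr]; exists n; elim: n r nr => [r ->|n IH r [u Ru ru]].
    by rewrite mulr0 mul0r subrr.
  exists (Dx * u - u * Dx); first exact: R0x.
  have cn : Dx * Dy ^+ n = Dy ^+ n * Dx.
    elim: (n) => [|k IHk]; first by rewrite mul1r mulr1.
    by rewrite exprS mulrA lpdo_DxDy -mulrA IHk mulrA.
  rewrite (_ : _ - _ = Dx * (r - u * Dy ^+ n) - (r - u * Dy ^+ n) * Dx); first exact: IH.
  rewrite mulrBr !mulrBl -!mulrA cn !opprB addrACA [RHS]addrACA.
  by congr (_ + _); rewrite addrC.
have R2noeth : noetherian (adjoin R1 Dx).
  by do 2!apply: hilbert_basis => //.
have R2T : adjoin R1 Dx = setT.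
  have [R21 R2B R2M] := adjoin_subring R1ring R1x.
  have R20 : adjoin R1 Dx 0 by rewrite -(subrr 1); exact: R2B.
  apply/seteqP; split=> // p _; elim/lpdo_ind: p => //.
  - move=> p q pR qR; rewrite -[q]opprK; apply: (R2B) => //.
    by rewrite -sub0r; exact: R2B.
  - by move=> a p pR; apply: R2M => //; do 2!apply: adjoinW => //; exists a.
  - by move=> p pR; apply: R2M => //; exact: adjoin_gen.
  - by move=> p pR; apply: R2M => //; apply: adjoinW => //; exact: adjoin_gen.
move=> [I0 ID IM]; rewrite -R2T; apply: R2noeth; first by rewrite R2T.
by split=> // r a _; exact: IM.
Qed.

End Operators.

(** * The domain of divided power series in one variable *)

Section Hurwitz.
Variables (R : idomainType) (charR : [pchar R] =i pred0).

(* [charR] is recorded in the type so that the domain structure, which depends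
   on it, can be inferred. *)
Definition hurwitz : Type := let _ := charR in nat -> R.

HB.instance Definition _ := GRing.Zmodule.copy hurwitz (nat -> R).

Implicit Types f g h : hurwitz.

Let charRn n : (n%:R == 0 :> R) = (n == 0)%N.
Proof. by move/pcharf0P: charR. Qed.

Lemma hurwitz_ext f g : (forall n, f n = g n) -> f = g.
Proof. by move=> fg; apply/funext. Qed.

Lemma hurwitzD f g n : (f + g) n = f n + g n. Proof. by []. Qed.
Lemma hurwitzN f n : (- f) n = - f n. Proof. by []. Qed.

Definition hshift f : hurwitz := fun n => f n.+1.

(* [f] stands for the divided power series sum_n (f n) X^n / n!, with
   derivation [hshift]; the product is the one satisfying the Leibniz rule. *)
Fixpoint hcoef_mul n f g : R :=
  if n is m.+1 then hcoef_mul m (hshift f) g + hcoef_mul m f (hshift g)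
  else f 0 * g 0.

Definition hmul f g : hurwitz := fun n => hcoef_mul n f g.
Definition hconst (a : R) : hurwitz := fun n => if n is 0 then a else 0.

Lemma hshiftD : {morph hshift : f g / f + g}. Proof. by []. Qed.

Lemma hshiftM f g : hshift (hmul f g) = hmul (hshift f) g + hmul f (hshift g).
Proof. by []. Qed.

Lemma hshift_const a : hshift (hconst a) = 0.
Proof. by apply: hurwitz_ext. Qed.

Let hmulS f g n : hmul f g n.+1 = hmul (hshift f) g n + hmul f (hshift g) n.
Proof. by []. Qed.

Lemma hmulC : commutative hmul.
Proof.
move=> f g; apply: hurwitz_ext => n; elim: n f g => [|n IH] f g.
  exact: mulrC.
by rewrite !hmulS addrC (IH f) (IH (hshift f)).
Qed.

Lemma hmulDl : left_distributive hmul +%R.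
Proof.
move=> f g h; apply: hurwitz_ext => n; elim: n f g h => [|n IH] f g h.
  exact: mulrDl.
by rewrite hurwitzD !hmulS hshiftD !IH !hurwitzD addrACA.
Qed.

Lemma hmulA : associative hmul.
Proof.
move=> f g h; apply: hurwitz_ext => n; elim: n f g h => [|n IH] f g h.
  exact: mulrA.
have hmulDr u v w : hmul u (v + w) = hmul u v + hmul u w.
  by rewrite hmulC hmulDl (hmulC v) (hmulC w).
by rewrite !hmulS !hshiftM hmulDl hmulDr !hurwitzD !IH addrA.
Qed.

Lemma hmul0 : left_zero 0 hmul.
Proof.
move=> f; apply: hurwitz_ext => n; elim: n f => [|n IH] f; first exact: mul0r.
by rewrite hmulS [hshift 0](_ : _ = 0) // !IH addr0.
Qed.

Lemma hmul1 : left_id (hconst 1) hmul.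
Proof.
move=> f; apply: hurwitz_ext => n; elim: n f => [|n IH] f; first exact: mul1r.
by rewrite hmulS hshift_const hmul0 IH add0r.
Qed.

Lemma hconst1_neq0 : hconst 1 != 0.
Proof.
by apply/eqP => /(congr1 (fun f : hurwitz => f 0)) /eqP; rewrite oner_eq0.
Qed.

HB.instance Definition _ := GRing.Zmodule_isComNzRing.Build hurwitz
  hmulA hmulC hmul1 hmulDl hconst1_neq0.

Lemma hurwitzS f g n : (f * g) n.+1 = (hshift f * g) n + (f * hshift g) n.
Proof. by []. Qed.

(** In divided powers, X^m/m! times X^n/n! is 'C(m + n, m) X^(m + n)/(m + n)!; along the recursion
    defining the product this is Pascal's rule. *)
Lemma hurwitz_lead m n f g : (forall i, (i < m)%N -> f i = 0) ->
  (forall i, (i < n)%N -> g i = 0) -> (f * g) (m + n)%N = (f m * g n) *+ 'C(m + n, m).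
Proof.
have vanish k l f' g' : (l < k)%N -> (forall i, (i < k)%N -> g' i = 0) ->
    (f' * g') l = 0.
  elim: l k f' g' => [|l IH] k f' g' lk gk.
    by rewrite -[LHS]/(f' 0%N * g' 0%N) gk ?mulr0.
  rewrite hurwitzS (IH k) ?(ltnW lk) // add0r.
  apply: (IH k.-1) => [|i ik]; first by case: (k) lk.
  by apply: gk; case: (k) ik => // k' ik; rewrite ltnS.
move: {2}(m + n)%N (erefl (m + n)%N) => k; elim: k m n f g.
  by case=> // -[|n] // f g _ _ _; rewrite bin0.
move=> k IH [|m] [|n] f g mn fm gn //.
- rewrite add0n hurwitzS (vanish n.+1) // add0r bin0.
  by rewrite -[n]add0n IH ?bin0 //; [case: mn | move=> i ?; exact: gn].
- rewrite addn0 hurwitzS [X in _ + X](_ : _ = 0).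
    rewrite addr0 -[m]addn0 IH //; first by rewrite !addn0 !binn.
      by case: mn; rewrite addn0.
    by move=> i im; apply: fm.
  by rewrite mulrC (vanish m.+1).
rewrite addnS hurwitzS binS mulrnDr addrC; congr (_ + _).
  by apply: IH => // [|i ?]; [case: mn => <-; rewrite addnS | exact: gn].
by rewrite addSnnS; apply: IH => // [|i ?]; [case: mn => <- | exact: fm].
Qed.

Lemma hurwitz_neq0 f : f != 0 -> exists2 n, f n != 0 & forall i, (i < n)%N -> f i = 0.
Proof.
move=> f0; have exf : exists n, f n != 0.
  apply: contrapT => nf; case/eqP: f0; apply: hurwitz_ext => n.
  by apply/eqP/negPn/negP => fn; case: nf; exists n.
exists (ex_minn exf); case: ex_minnP => // n _ min i.
by apply: contraTeq => /min; rewrite leqNgt.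
Qed.

(** The product of the lowest nonzero terms survives because binomial coefficients do not vanish in
    characteristic zero. *)
Lemma hurwitz_idomain f g : f * g = 0 -> (f == 0) || (g == 0).
Proof.
move=> fg0; apply/norP => -[/hurwitz_neq0[m fm fi] /hurwitz_neq0[n gn gi]].
have := hurwitz_lead fi gi; rewrite fg0 => /esym/eqP.
by rewrite -mulr_natr !mulf_eq0 (negPf fm) (negPf gn) charRn eqn0Ngt
  bin_gt0 leq_addr.
Qed.

(** Units are taken abstractly: the structure of an integral domain asks for a unit predicate and an
    inverse, but no description of the units is wanted here. *)
Definition hunit : {pred hurwitz} := fun f => `[< exists g, g * f = 1 >].
Definition hinv f : hurwitz :=
  if pselect (exists g, g * f = 1) is left fV then sval (cid fV) else f.

Lemma hmulVf : {in hunit, left_inverse 1 hinv *%R}.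
Proof.
move=> f /asboolP fu; rewrite /hinv; case: pselect => // fV.
by case: cid.
Qed.

Lemma hunitP f g : g * f = 1 -> hunit f.
Proof. by move=> gf; apply/asboolP; exists g. Qed.

Lemma hinv_out : {in [predC hunit], hinv =1 id}.
Proof.
by move=> f /asboolP fu; rewrite /hinv; case: pselect.
Qed.

HB.instance Definition _ := GRing.ComNzRing_hasMulInverse.Build hurwitz
  hmulVf hunitP hinv_out.
HB.instance Definition _ := GRing.ComUnitRing_isIntegral.Build hurwitz
  hurwitz_idomain.

(** This permits iterating the construction, which gives series in two variables. *)
Lemma hurwitz_char0 : [pchar hurwitz] =i pred0.
Proof.
apply/pcharf0P => n; rewrite -charRn.
have E : (n%:R : hurwitz) 0 = n%:R.
  by elim: n => // n IH; rewrite -addn1 !natrD hurwitzD IH.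
apply/eqP/eqP => [n0|n0]; first by rewrite -E n0.
have {}n0 : (n == 0)%N by rewrite -charRn n0.
by rewrite (eqP n0).
Qed.

End Hurwitz.

(** * Coefficientwise derivations and Taylor expansion *)

Section Lift.
Variables (R : idomainType) (charR : [pchar R] =i pred0).
Local Notation H := (hurwitz charR).
Implicit Types f g : H.

Definition hlift (d : R -> R) f : H := fun n => d (f n).

Lemma hliftD (d : {additive R -> R}) : {morph hlift d : f g / f + g}.
Proof. by move=> f g; apply: hurwitz_ext => n; exact: raddfD. Qed.

HB.instance Definition _ := GRing.isZmodMorphism.Build H H (@hshift R charR)
  (additive_zmod_morphism (@hshiftD R charR)).
HB.instance Definition _ (d : {additive R -> R}) :=
  GRing.isZmodMorphism.Build H H (hlift d) (additive_zmod_morphism (hliftD d)).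

Lemma hliftM (d : {additive R -> R}) : (forall a b, d (a * b) = d a * b + a * d b) ->
  forall f g, hlift d (f * g) = hlift d f * g + f * hlift d g.
Proof.
move=> dM f g; apply: hurwitz_ext => n.
elim: n f g => [|n IH] f g; first exact: dM.
rewrite hurwitzD !hurwitzS /hlift hurwitzS raddfD /=.
by rewrite -!/(hlift d _ n) !IH !hurwitzD addrACA.
Qed.

Variables (A : comNzRingType) (phi : {rmorphism A -> R}) (d : {additive A -> A}).
Hypothesis dM : forall a b, d (a * b) = d a * b + a * d b.

(** The Taylor expansion of [a] along [d]. It is multiplicative because the product of series obeys
    the Leibniz rule for [hshift], as [d] does for its own product. *)
Definition taylor (a : A) : H := fun n => phi (iter n d a).

Lemma taylor_der a : taylor (d a) = hshift (taylor a).
Proof. by apply: hurwitz_ext => n; rewrite /hshift /taylor iterSr. Qed.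

Lemma taylor_zmod_morphism : zmod_morphism taylor.
Proof.
move=> a b; apply: hurwitz_ext => n; rewrite hurwitzD hurwitzN /taylor -raddfB.
by congr (phi _); elim: n => //= n ->; rewrite raddfB.
Qed.

Lemma taylor_monoid_morphism : monoid_morphism taylor.
Proof.
split; last first.
  move=> a b; apply: hurwitz_ext => n.
  elim: n a b => [|n IH] a b; first exact: rmorphM.
  rewrite hurwitzS -!taylor_der -!IH /taylor -raddfD.
  by rewrite iterSr dM; congr (phi _); elim: n {IH} => //= n ->; rewrite raddfD.
have d1 : d 1 = 0.
  by apply: (addIr (d 1)); rewrite -{3}[1]mulr1 dM mulr1 mul1r add0r.
apply: hurwitz_ext => -[|n]; first exact: rmorph1.
rewrite /taylor iterSr d1 (_ : iter n d 0 = 0) ?raddf0 //.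
by elim: n => //= n ->; rewrite raddf0.
Qed.

End Lift.

(** * Extending derivations to the fraction field *)

Section FractionDerivation.
Variable R : idomainType.
Local Notation K := {fraction R}.
Local Notation "x %:F" := (@FracField.tofrac R x).
Implicit Types (a b c : R) (x y : K).

Lemma fraction_repr x : exists ab : R * R, ab.2 != 0 /\ x * ab.2%:F = ab.1%:F.
Proof.
elim/quotW: x => r; exists (\n_r, \d_r); split; first exact: denom_ratioP.
apply/eqP; unlock FracField.tofrac; rewrite -[_ * _]FracField.pi_mul.
rewrite piE /= FracField.equivfE /FracField.mulf.
by rewrite !numden_Ratio ?mulf_neq0 ?denom_ratioP ?oner_eq0 // !mulr1 mulrC.
Qed.

Variable d : {additive R -> R}.
Hypothesis dM : forall a b, d (a * b) = d a * b + a * d b.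

(** The quotient rule for x = a/b in the form (d a - x d b)/b, at a chosen pair (a, b). *)
Definition fraction_der x : K :=
  let ab := sval (cid (fraction_repr x)) in
  ((d ab.1)%:F - x * (d ab.2)%:F) / ab.2%:F.

Local Notation D := fraction_der.

(** Independence of the chosen pair: differentiate the relation a b' = a' b between two
    representations of x. *)
Lemma fraction_derP x a b : b != 0 -> x * b%:F = a%:F ->
  D x * b%:F = (d a)%:F - x * (d b)%:F.
Proof.
rewrite /D; case: cid => -[a' b'] /= [b'0 xb'] b0 xb.
have F0 c : c != 0 -> c%:F != 0 by rewrite tofrac_eq0.
have /(congr1 (fun c => (d c)%:F)) : a * b' = a' * b.
  by apply/eqP; rewrite -tofrac_eq !tofracM -xb -xb' mulrAC.
rewrite !dM !tofracD !tofracM -xb -xb' => E.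
apply: (mulIf (F0 _ b'0)); rewrite mulrAC divfK ?F0 //.
rewrite !mulrBl; apply/eqP; rewrite -subr_eq0; apply/eqP.
move/eqP: E; rewrite -subr_eq0 => /eqP E.
by rewrite -[RHS]oppr0 -E; ring.
Qed.

Lemma fraction_derF a : D a%:F = (d a)%:F.
Proof.
have := @fraction_derP a%:F a 1 (oner_neq0 _); rewrite tofrac1 !mulr1 => -> //.
have d1 : d 1 = 0.
  by apply: (addIr (d 1)); rewrite -{3}[1]mulr1 dM mulr1 mul1r add0r.
by rewrite d1 tofrac0 mulr0 subr0.
Qed.

Lemma fraction_derD : {morph D : x y / x + y}.
Proof.
move=> x y; have [[a b] /= [b0 xb]] := fraction_repr x.
have [[c e] /= [e0 ye]] := fraction_repr y.
have be0 : b * e != 0 by rewrite mulf_neq0.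
have xybe : (x + y) * (b * e)%:F = (a * e + c * b)%:F.
  by rewrite tofracD !tofracM -xb -ye; ring.
have /(mulIf (_ : (b * e)%:F != 0)) : D (x + y) * (b * e)%:F = (D x + D y) * (b * e)%:F.
  rewrite (fraction_derP be0 xybe) tofracM.
  have -> : (D x + D y) * (b%:F * e%:F) = (D x * b%:F) * e%:F + (D y * e%:F) * b%:F.
    by ring.
  rewrite (fraction_derP b0 xb) (fraction_derP e0 ye) raddfD /= !dM !tofracD !tofracM.
  by rewrite -xb -ye; ring.
by apply; rewrite tofrac_eq0.
Qed.

Lemma fraction_derM x y : D (x * y) = D x * y + x * D y.
Proof.
have [[a b] /= [b0 xb]] := fraction_repr x.
have [[c e] /= [e0 ye]] := fraction_repr y.
have be0 : b * e != 0 by rewrite mulf_neq0.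
have xybe : (x * y) * (b * e)%:F = (a * c)%:F.
  by rewrite !tofracM -xb -ye; ring.
have /(mulIf (_ : (b * e)%:F != 0)) :
    D (x * y) * (b * e)%:F = (D x * y + x * D y) * (b * e)%:F.
  rewrite (fraction_derP be0 xybe) tofracM.
  have -> : (D x * y + x * D y) * (b%:F * e%:F) =
      (D x * b%:F) * (y * e%:F) + (x * b%:F) * (D y * e%:F) by ring.
  rewrite (fraction_derP b0 xb) (fraction_derP e0 ye) !dM !tofracD !tofracM.
  by rewrite -xb -ye; ring.
by apply; rewrite tofrac_eq0.
Qed.

End FractionDerivation.

(** Differentiating x b = a by [e] and then by [d] expresses the second derivative of x, multiplied
    by b, through terms symmetric in [d] and [e]. *)
Lemma fraction_derC (R : idomainType) (d e : {additive R -> R}) :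
  (forall a b, d (a * b) = d a * b + a * d b) ->
  (forall a b, e (a * b) = e a * b + a * e b) ->
  (forall a, d (e a) = e (d a)) ->
  forall x, fraction_der d (fraction_der e x) = fraction_der e (fraction_der d x).
Proof.
move=> dM eM deC x; have [[a b] /= [b0 xb]] := fraction_repr x.
have twice (d' e' : {additive R -> R}) :
    (forall a b, d' (a * b) = d' a * b + a * d' b) ->
    (forall a b, e' (a * b) = e' a * b + a * e' b) ->
    fraction_der d' (fraction_der e' x) * FracField.tofrac b =
    FracField.tofrac (d' (e' a)) - x * FracField.tofrac (d' (e' b)) -
    (fraction_der d' x * FracField.tofrac (e' b) +
     fraction_der e' x * FracField.tofrac (d' b)).
  move=> d'M e'M; have := congr1 (fraction_der d') (fraction_derP e'M b0 xb).
  have fderB : {morph fraction_der d' : y z / y - z}.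
    by apply: additive_zmod_morphism; exact: fraction_derD.
  rewrite fderB !(fraction_derM d'M) !(fraction_derF d'M) => E.
  by apply: (addIr (fraction_der e' x * FracField.tofrac (d' b))); rewrite E; ring.
apply: (mulIf (_ : FracField.tofrac b != 0)); first by rewrite tofrac_eq0.
by rewrite !twice // !deC; ring.
Qed.

(** * The differential field of fractions of Taylor series in two variables *)

Section TaylorField.
Variables (F : pdiffFieldType) (charF : [pchar F] =i pred0).

Definition taylor_x : F -> hurwitz charF := taylor charF idfun (@dx F).

HB.instance Definition _ := GRing.isZmodMorphism.Build F (hurwitz charF) taylor_x
  (@taylor_zmod_morphism F charF F idfun (@dx F)).
HB.instance Definition _ := GRing.isMonoidMorphism.Build F (hurwitz charF) taylor_x
  (@taylor_monoid_morphism F charF F idfun (@dx F) (@dxM F)).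

(** The outer index counts dy and the inner one dx: the entry of [taylor_xy a] at l, i is dx^i dy^l
    a. Hence dx is the inner shift and dy the outer one. *)
Definition taylor_ring := hurwitz (hurwitz_char0 charF).

Definition taylor_xy : F -> taylor_ring :=
  taylor (hurwitz_char0 charF) taylor_x (@dy F).

HB.instance Definition _ := GRing.isZmodMorphism.Build F taylor_ring taylor_xy
  (@taylor_zmod_morphism _ (hurwitz_char0 charF) F taylor_x (@dy F)).
HB.instance Definition _ := GRing.isMonoidMorphism.Build F taylor_ring taylor_xy
  (@taylor_monoid_morphism _ (hurwitz_char0 charF) F taylor_x (@dy F) (@dyM F)).

Definition taylor_ring_dx : taylor_ring -> taylor_ring := hlift (@hshift _ charF).
Definition taylor_ring_dy : taylor_ring -> taylor_ring :=
  @hshift _ (hurwitz_char0 charF).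

HB.instance Definition _ := GRing.Additive.on taylor_ring_dx.
HB.instance Definition _ := GRing.Additive.on taylor_ring_dy.

Lemma taylor_ring_dxM a b :
  taylor_ring_dx (a * b) = taylor_ring_dx a * b + a * taylor_ring_dx b.
Proof. exact: hliftM. Qed.

Lemma taylor_ring_dyM a b :
  taylor_ring_dy (a * b) = taylor_ring_dy a * b + a * taylor_ring_dy b.
Proof. by []. Qed.

Lemma taylor_ring_dxdyC a :
  taylor_ring_dx (taylor_ring_dy a) = taylor_ring_dy (taylor_ring_dx a).
Proof. by []. Qed.

Lemma taylor_xy_dx a : taylor_xy (dx a) = taylor_ring_dx (taylor_xy a).
Proof.
apply: hurwitz_ext => n; rewrite /taylor_ring_dx /hlift -taylor_der.
by congr (taylor_x _); elim: n => //= n ->; rewrite dxdyC.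
Qed.

Lemma taylor_xy_dy a : taylor_xy (dy a) = taylor_ring_dy (taylor_xy a).
Proof. exact: taylor_der. Qed.

(** Fractions are taken because [differentially_closed] speaks of extensions that are fields. *)
Definition taylor_field : Type := {fraction taylor_ring}.

HB.instance Definition _ := GRing.Field.on taylor_field.
HB.instance Definition _ := Field_isPDiffField.Build taylor_field
  (fraction_derD taylor_ring_dxM) (fraction_derD taylor_ring_dyM)
  (fraction_derM taylor_ring_dxM) (fraction_derM taylor_ring_dyM)
  (fraction_derC taylor_ring_dxM taylor_ring_dyM taylor_ring_dxdyC).

Definition taylor_embed : {rmorphism F -> taylor_field} :=
  @FracField.tofrac taylor_ring \o taylor_xy.

Lemma taylor_embed_diff : diff_morphism taylor_embed.
Proof.
split=> a /=; rewrite ?taylor_xy_dx ?taylor_xy_dy; apply/esym.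
  exact: (fraction_derF taylor_ring_dxM).
exact: (fraction_derF taylor_ring_dyM).
Qed.

End TaylorField.

(** * Extension of linear functionals from a left ideal *)

Section Functional.
Variable F : pdiffFieldType.
Implicit Types (a c : F) (p q : lpdo F).

Definition F_linear_on (I : set (lpdo F)) (lam : lpdo F -> F) :=
  (forall p q, I p -> I q -> lam (p + q) = lam p + lam q) /\
  (forall a p, I p -> lam (lpdoC a * p) = a * lam p).

(* Zorn's lemma on the subspaces of [lpdo F * F] that contain the graph of
   [psi] but not [(0, 1)]: a maximal one is the graph of a functional. *)
Lemma functional_extension (I : set (lpdo F)) (psi : lpdo F -> F) :
  submodule setT I -> F_linear_on I psi ->
  exists2 lam : lpdo F -> F, F_linear_on setT lam & forall p, I p -> lam p = psi p.
Proof.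
move=> [I0 ID IM] [psiD psiZ].
pose sub (B : set (lpdo F * F)) :=
  [/\ forall p q a c, B (p, a) -> B (q, c) -> B (p + q, a + c)
    & forall a p c, B (p, c) -> B (lpdoC a * p, a * c)].
pose G : set (lpdo F * F) := [set pc | I pc.1 /\ pc.2 = psi pc.1].
pose good B := sub B /\ ~ B (0, 1).
have C0 p : lpdoC 0 * p = 0 by rewrite lpdoCE /lpdo_scale scale0r.
have psi0 : psi 0 = 0 by rewrite -(C0 0) psiZ // mul0r.
have goodG : good G.
  split; first split=> [p q a c [/= Ip ->] [/= Iq ->]|a p c [/= Ip ->]].
  - by split; [exact: ID|rewrite /= psiD].
  - by split; [exact: IM|rewrite /= psiZ].
  by move=> [_ /= /eqP]; rewrite psi0 oner_eq0.
have [A [goodA maxA]] : exists A, good (A `|` G) /\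
    forall B, A `<` B -> ~ good (B `|` G).
  (* Asking for [A] together with [G] to be good takes care of the empty chain, whose union is then
     completed to [G]. *)
  apply: (@Zorn_bigcup _ (fun A => good (A `|` G))) => C Cgood Ctot.
  set U := _ `|` G.
  have common x y : U x -> U y -> exists B, [/\ good B, B `<=` U, B x & B y].
    have sU A : C A -> A `|` G `<=` U.
      by move=> CA z [Az|Gz]; [left; exists A|right].
    move=> [[A CA Ax]|Gx] [[B CB By]|Gy].
    - have [AB|BA] := Ctot A B CA CB.
        by exists (B `|` G); split; [exact: Cgood|exact: sU|left; exact: AB|left].
      by exists (A `|` G); split; [exact: Cgood|exact: sU|left|left; exact: BA].
    - by exists (A `|` G); split; [exact: Cgood|exact: sU|left|right].
    - by exists (B `|` G); split; [exact: Cgood|exact: sU|right|left].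
    - by exists G; split=> // z Gz; right.
  split; first split=> [p q a c Up Uq|a p c Up].
  - by have [B [[[BD _] _] BU Bp Bq]] := common _ _ Up Uq; apply/BU/BD.
  - by have [B [[[_ BZ] _] BU Bp _]] := common _ _ Up Up; apply/BU/BZ.
  by move=> U1; have [B [[_ B1] _ /B1]] := common _ _ U1 U1.
move: goodA; set B := A `|` G => -[[BD BZ] B1].
have BG p c : G (p, c) -> B (p, c) by right.
have B0 : B (0, 0) by apply: BG; split.
have maxB B' : B `<=` B' -> good B' -> B' `<=` B.
  move=> BB' gB'; apply: contrapT => nB'B; apply: (maxA B').
    split; last by move=> B'A; apply: nB'B => z /B'A; left.
    by move=> z Az; apply: BB'; left.
  by rewrite (_ : B' `|` G = B') //; apply/setUidPl => z Gz; apply: BB'; right.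
have total p : exists c, B (p, c).
  apply: contrapT => np.
  (* The subspace spanned by [B] and (p, 0). If it avoided (0, 1), maximality would put (p, 0) in
     [B]; otherwise [B] contains some (- k p, 1) with k nonzero, and rescaling gives p a value. *)
  pose B' : set (lpdo F * F) := [set qc | exists k, B (qc.1 - lpdoC k * p, qc.2)].
  have B'p : B' (p, 0) by exists 1; rewrite /= mul1r subrr.
  have BB' : B `<=` B' by move=> [q c] Bq; exists 0; rewrite /= C0 subr0.
  have [k /= Bk] : B' (0, 1).
    apply: contrapT => B'1; apply: np; exists 0; apply: (maxB B') => //.
    split=> //; split=> [q r a c [k Bq] [l Br]|a q c [k Bq]].
      by exists (k + l); rewrite /= lpdoCD mulrDl opprD addrACA; exact: BD.
    by exists (a * k); rewrite /= lpdoCM -mulrA -mulrBr; exact: BZ.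
  have k0 : k != 0.
    by apply: contra_notN B1 => /eqP k0; move: Bk; rewrite k0 C0 subr0.
  apply: np; exists (- k^-1 * 1).
  have -> : p = lpdoC (- k^-1) * (0 - lpdoC k * p).
    by rewrite sub0r mulrN mulrA -lpdoCM mulNr mulVf // lpdoCN mulNr opprK mul1r.
  exact: BZ.
(* Two values for p would give (0, c - c'), a nonzero multiple of (0, 1). *)
have unique p c c' : B (p, c) -> B (p, c') -> c = c'.
  move=> Bc Bc'; apply/eqP; rewrite -subr_eq0; apply: contra_notT B1 => cc'.
  have Bcc : B (0, c - c').
    have := BD _ _ _ _ Bc (BZ (- 1) _ _ Bc').
    by rewrite lpdoCN mulNr mul1r subrr mulN1r.
  by have := BZ (c - c')^-1 _ _ Bcc; rewrite mulr0 mulVf.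
have /choice[lam lamP] := total.
exists lam => [|p Ip]; last by apply: (unique p) => //; apply: BG.
split=> [p q _ _|a p _]; [apply: (unique (p + q))|apply: (unique (lpdoC a * p))] => //.
  exact: BD.
exact: BZ.
Qed.

End Functional.

Lemma lpdo_eval_morph (F : pdiffFieldType) (M N : zmodType)
    (sc : F -> M -> M) (sc' : F -> N -> N) ex ey ex' ey' (phi : {additive M -> N}) :
  (forall a w, phi (sc a w) = sc' a (phi w)) ->
  (forall w, phi (ex w) = ex' (phi w)) -> (forall w, phi (ey w) = ey' (phi w)) ->
  forall p w, phi (lpdo_eval sc ex ey p w) = lpdo_eval sc' ex' ey' p (phi w).
Proof.
move=> phiZ phix phiy p w; rewrite /lpdo_eval raddf_sum; apply: eq_bigr => i _.
rewrite raddf_sum; apply: eq_bigr => j _; rewrite phiZ; congr sc'.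
move: (nat_of_ord i) (nat_of_ord j) => k l.
elim: k => [|k IH] /=; last by rewrite phix IH.
by elim: l => //= l <-; rewrite phiy.
Qed.

(** * Linear operators as differential polynomials *)

Section FieldAction.
Variables (F E : pdiffFieldType) (j : {rmorphism F -> E}).

Fixpoint diff_poly_sum (s : seq (diff_poly F)) : diff_poly F :=
  if s is P :: s' then DAdd P (diff_poly_sum s') else DConst 0.

Definition diff_poly_of_lpdo (p : lpdo F) : diff_poly F :=
  diff_poly_sum [seq diff_poly_sum
    [seq DMul (DConst p`_i`_l) (DVar F 0 i l) | l <- iota 0 (size p`_i)]
  | i <- iota 0 (size p)].

Lemma diff_poly_of_lpdoP p u :
  diff_poly_eval j u (diff_poly_of_lpdo p) =
  lpdo_eval (fun a w => j a * w) dx dy p (u 0%N).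
Proof.
have sumE s : diff_poly_eval j u (diff_poly_sum s) =
    \sum_(P <- s) diff_poly_eval j u P.
  by elim: s => [|P s IH]; rewrite ?big_nil ?big_cons /= ?raddf0 ?IH.
have iotaE n (h : nat -> E) : \sum_(i <- iota 0 n) h i = \sum_(i < n) h i.
  by rewrite -(big_mkord xpredT) /index_iota subn0.
by rewrite sumE big_map iotaE; apply: eq_bigr => i _; rewrite sumE big_map iotaE.
Qed.

End FieldAction.

(** * Injectivity of F over F[dx, dy] *)

Section FieldInjective.
Variables (F : pdiffFieldType).
Implicit Types (p q : lpdo F).

Definition lpdo_act p (h : F) : F := lpdo_eval *%R dx dy p h.

Lemma field_leibniz : leibniz_action *%R (@dx F) dy.
Proof.
split; [exact: mulrA|exact: mul1r|by move=> w a b; exact: mulrDl|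
  by move=> a v w; exact: mulrDr|exact: dxD|exact: dyD|exact: dxM|exact: dyM|
  exact: dxdyC].
Qed.

Lemma lpdo_actM p q h : lpdo_act (p * q) h = lpdo_act p (lpdo_act q h).
Proof. exact: (lpdo_evalM field_leibniz). Qed.

Lemma lpdo_act_dx h : lpdo_act (Dx F) h = dx h.
Proof.
rewrite [LHS](lpdo_eval_dx field_leibniz).
by rewrite [X in dx X](lpdo_evalC field_leibniz 1) mul1r.
Qed.

Lemma lpdo_act_dy h : lpdo_act (Dy F) h = dy h.
Proof.
rewrite [LHS](lpdo_eval_dy field_leibniz).
by rewrite [X in dy X](lpdo_evalC field_leibniz 1) mul1r.
Qed.

Lemma lpdo_act0 p : lpdo_act p 0 = 0.
Proof.
by apply: (addIr (lpdo_act p 0)); rewrite -[LHS](lpdo_evalDr field_leibniz) !add0r.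
Qed.

Variable charF : [pchar F] =i pred0.
Local Notation T := (taylor_ring charF).

Definition taylor_scale (a : F) (w : T) : T := taylor_xy charF a * w.

Lemma taylor_leibniz :
  leibniz_action taylor_scale (@taylor_ring_dx F charF) (@taylor_ring_dy F charF).
Proof.
split.
- by move=> a b w; rewrite /taylor_scale mulrA rmorphM.
- by move=> w; rewrite /taylor_scale rmorph1 mul1r.
- by move=> w a b; rewrite /taylor_scale raddfD mulrDl.
- by move=> a v w; rewrite /taylor_scale mulrDr.
- exact: raddfD.
- exact: raddfD.
- by move=> a w; rewrite /taylor_scale taylor_ring_dxM taylor_xy_dx.
- by move=> a w; rewrite /taylor_scale taylor_ring_dyM taylor_xy_dy.
exact: taylor_ring_dxdyC.
Qed.

Local Notation evT := (lpdo_eval taylor_scale (@taylor_ring_dx F charF)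
  (@taylor_ring_dy F charF)).

(* The ring of Taylor series is the coinduced module Hom_F(F[dx, dy], F), so
   that linear systems over it are solved by extending [F]-linear maps. *)
Lemma taylor_solve (I : set (lpdo F)) (psi : lpdo F -> F) :
  submodule setT I -> (forall p q, I p -> I q -> psi (p + q) = psi p + psi q) ->
  (forall p q, I q -> psi (p * q) = lpdo_act p (psi q)) ->
  exists u : T, forall q, I q -> evT q u = taylor_xy charF (psi q).
Proof.
move=> IP psiD psiM; have [_ _ IM] := IP.
have [|lam [lamD lamZ] lampsi] := @functional_extension F I psi IP.
  split=> // a p Ip; rewrite psiM // /lpdo_act.
  exact: (lpdo_evalC field_leibniz).
pose mono i l p := iter i (@lpdo_dx F) (iter l (@lpdo_dy F) p).
have iterT i l (w : T) : iter i (@taylor_ring_dx F charF)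
    (iter l (@taylor_ring_dy F charF) w) 0%N 0%N = w l i.
  have yE (v : T) : iter l (@taylor_ring_dy F charF) v 0%N = v l.
    by elim: l v => // l IH v; rewrite iterSr IH.
  have xE (v : T) k : iter i (@taylor_ring_dx F charF) v 0%N k = v 0%N (k + i)%N.
    by elim: i v => [|i IH] v; rewrite ?addn0 // iterSr IH addnS.
  by rewrite xE yE.
(* With the values of [lam] at the monomials dx^i dy^l as coefficients, [lam] p becomes the constant
   term of p [u]. *)
pose u : T := fun l i => lam (mono i l 1).
have lamE p : evT p u 0%N 0%N = lam p.
  pose c (w : T) : F := w 0%N 0%N.
  have cD : {morph c : v w / v + w} by [].
  have lam0 : lam 0 = 0 by apply: (addIr (lam 0)); rewrite -lamD ?add0r.
  rewrite -[in RHS](mulr1 p) -[p * 1]/(lpdo_eval _ _ _ p 1).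
  rewrite -/(c _) /lpdo_eval (big_morph c cD (erefl _)).
  rewrite (big_morph lam (fun p q => lamD p q Logic.I Logic.I) lam0).
  apply: eq_bigr => i _; rewrite (big_morph c cD (erefl _)).
  rewrite (big_morph lam (fun p q => lamD p q Logic.I Logic.I) lam0).
  apply: eq_bigr => l _; rewrite -lpdoCE lamZ //; congr (_ * _).
  exact: iterT.
exists u => q Iq; apply: hurwitz_ext => l; apply: hurwitz_ext => i.
(* The coefficient of q [u] at l, i is the constant term of dx^i dy^l q [u], and dx^i dy^l q is
   again in [I], where [lam] agrees with [psi]. *)
have monoE : evT (mono i l q) u = iter i (@taylor_ring_dx F charF)
    (iter l (@taylor_ring_dy F charF) (evT q u)).
  rewrite /mono; elim: i => [|i IH] /=; last first.
    by rewrite (lpdo_eval_dx taylor_leibniz) IH.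
  by elim: l => //= l IH; rewrite (lpdo_eval_dy taylor_leibniz) IH.
have monoI : I (mono i l q) /\ psi (mono i l q) = iter i dx (iter l dy (psi q)).
  rewrite /mono; elim: i {monoE} => [|i [IH1 IH2]] /=; last first.
    by rewrite lpdo_dxE; split; [exact: IM|rewrite psiM // lpdo_act_dx IH2].
  elim: l => [|l [IH1 IH2]] //=.
  by rewrite lpdo_dyE; split; [exact: IM|rewrite psiM // lpdo_act_dy IH2].
by rewrite -iterT -monoE lamE (lampsi _ monoI.1) monoI.2.
Qed.

Lemma field_injective (closedF : differentially_closed F) (I : set (lpdo F))
    (psi : lpdo F -> F) :
  left_ideal I -> (forall p q, I p -> I q -> psi (p + q) = psi p + psi q) ->
  (forall p q, I q -> psi (p * q) = lpdo_act p (psi q)) ->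
  exists h, forall p, I p -> psi p = lpdo_act p h.
Proof.
move=> Iideal psiD psiM; have [I0 ID IM] := Iideal.
have IP : submodule setT I by split=> // r a _; exact: IM.
have [u uP] := taylor_solve IP psiD psiM.
have [g [gI gen]] := lpdo_noetherian Iideal.
pose sys := [seq DAdd (diff_poly_of_lpdo p) (DConst (- psi p)) | p <- g].
have [|h] := closedF _ _ (taylor_embed_diff charF) sys.
  exists (fun _ => FracField.tofrac u); rewrite all_map; apply/allP => p /gI Ip /=.
  rewrite diff_poly_of_lpdoP !rmorphN subr_eq0 /= -uP //; apply/eqP/esym.
  apply: lpdo_eval_morph => [a w|w|w]; first by rewrite -rmorphM.
    by rewrite [RHS](fraction_derF (@taylor_ring_dxM F charF)).
  by rewrite [RHS](fraction_derF (@taylor_ring_dyM F charF)).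
rewrite all_map => /allP hP.
have gP p : p \in g -> psi p = lpdo_act p (h 0%N).
  move=> pg; have := hP _ pg.
  by rewrite /= (@diff_poly_of_lpdoP F F idfun) subr_eq0 => /eqP.
have psi0 : psi 0 = 0 by apply: (addIr (psi 0)); rewrite -psiD ?add0r.
exists (h 0%N) => p Ip.
(* The operators of [I] at which the equation holds form a left ideal, so the generators decide. *)
suff [] : (I `&` [set p | psi p = lpdo_act p (h 0%N)]) p by [].
apply: gen Ip => [|q qg]; last by split; [exact: gI|exact: gP].
split; first by split=> //=; rewrite psi0 [RHS](lpdo_eval0l field_leibniz).
  move=> q r [Iq /= qh] [Ir /= rh]; split; first exact: ID.
  by rewrite /= psiD // qh rh [RHS](lpdo_evalDl field_leibniz).
move=> q r _ [Ir /= rh]; split; first exact: IM.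
by rewrite /= psiM // rh lpdo_actM.
Qed.

End FieldInjective.

(** * Series as a module over F[dx, dy][X], X shifting exponents *)

Section SeriesAction.
Variables (F : pdiffFieldType) (k : nat) (s : 'I_k -> rat).
Local Notation ser := (frac_ser F s).
Local Notation step := ((common_denom s)%:R^-1 : rat).
Implicit Types (H K : ser) (f : 'I_k -> F) (p : lpdo F) (r b : rat).

Lemma step_gt0 : 0 < step.
Proof. by rewrite invr_gt0 ltr0n common_denom_gt0. Qed.

Lemma ser_ext H K : (forall r, H r = K r) -> H = K.
Proof. by move=> HK; apply/val_inj/funext. Qed.

Lemma serD H K r : (H + K) r = H r + K r. Proof. by []. Qed.
Lemma serB H K r : (H - K) r = H r - K r. Proof. by []. Qed.

Definition coef_at r H : F := H r.
HB.instance Definition _ r := GRing.isZmodMorphism.Build ser F (coef_at r)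
  (fun H K => serB H K r).

Lemma shift_closed H : (fun r => H (r - step)) \in @frac_series F k s.
Proof.
have q0 : (common_denom s)%:R != 0 :> rat by rewrite pnatr_eq0 -lt0n common_denom_gt0.
have [HZ [b Hb]] := frac_seriesP _ _ (valP H).
apply/frac_seriesP; split=> [r /HZ|]; last first.
  by exists (b + step) => r /Hb; rewrite lerBlDr.
by rewrite mulrBl mulVf // => rZ; rewrite -[_ * _](subrK 1) rpredD ?rpred1.
Qed.

(** Replaces G^{(r)} by G^{(r + 1/q)}, that is, multiplies by X. *)
Definition shift H : ser := FracSer (shift_closed H).

Lemma shiftE H r : shift H r = H (r - step). Proof. by []. Qed.

HB.instance Definition _ := GRing.isZmodMorphism.Build ser ser shift
  (fun H K => @ser_ext (shift (H - K)) (shift H - shift K) (fun r => erefl)).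

Lemma iter_shiftD n H K : iter n shift (H + K) = iter n shift H + iter n shift K.
Proof. by elim: n => //= n ->; rewrite raddfD. Qed.

Lemma iter_shift0 n : iter n shift 0 = 0.
Proof. by elim: n => //= n ->; rewrite raddf0. Qed.

Lemma iter_shiftE n H r : iter n shift H r = H (r - n%:R * step).
Proof.
elim: n r => [|n IH] r; first by rewrite mul0r subr0.
by rewrite iterS shiftE IH -addrA -opprD -addn1 natrD mulrDl mul1r [step + _]addrC.
Qed.

Lemma monomial_closed b (h : F) : b * (common_denom s)%:R \is a Num.int ->
  (fun r => if r == b then h else 0) \in @frac_series F k s.
Proof.
move=> bZ; apply/frac_seriesP; split=> [r|].
  by case: (r =P b) => [->//|_]; rewrite eqxx.
by exists b => r; case: (r =P b) => [->//|_]; rewrite eqxx.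
Qed.

(** The action with [f] as an argument on the common group [ser], so that the actions for the given
    [f] and for f = 0 can be compared. *)
Definition act f p H : ser := VG_act (f := f) p H.

Lemma actD f p H K : act f p (H + K) = act f p H + act f p K.
Proof. exact: (@VG_actDr F k s f p H K). Qed.

HB.instance Definition _ f p := GRing.isZmodMorphism.Build ser ser (act f p)
  (additive_zmod_morphism (@actD f p)).

Lemma actDl f p q H : act f (p + q) H = act f p H + act f q H.
Proof. exact: (@VG_actDl F k s f H p q). Qed.
Lemma actM f p q H : act f (p * q) H = act f p (act f q H).
Proof. by rewrite /act VG_actA. Qed.
Lemma act1 f H : act f 1 H = H.
Proof. exact: (@VG_act1 F k s f H). Qed.
Lemma act0 f H : act f 0 H = 0.
Proof. by apply: (addIr (act f 0 H)); rewrite -actDl !add0r. Qed.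

Lemma actC f a H r : act f (lpdoC a) H r = a * H r.
Proof. by rewrite /act /VG_act (lpdo_evalC (VG_leibniz s f)). Qed.

Lemma act_dx f H r :
  act f (Dx F) H r = dx (H r) + \sum_j dx (f j) * H (r - s j).
Proof.
rewrite /act /VG_act (lpdo_eval_dx (VG_leibniz s f)).
by rewrite [lpdo_eval _ _ _ _ _](@VG_act1 F k s f H).
Qed.

Lemma act_dy f H r :
  act f (Dy F) H r = dy (H r) + \sum_j dy (f j) * H (r - s j).
Proof.
rewrite /act /VG_act (lpdo_eval_dy (VG_leibniz s f)).
by rewrite [lpdo_eval _ _ _ _ _](@VG_act1 F k s f H).
Qed.

Lemma act_shift f p H : act f p (shift H) = shift (act f p H).
Proof.
apply/esym/(@lpdo_eval_morph F ser ser) => [a w|w|w]; apply: ser_ext => r //=.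
  by rewrite /series_der; congr (_ + _); apply: eq_bigr => j _; rewrite addrAC.
by rewrite /series_der; congr (_ + _); apply: eq_bigr => j _; rewrite addrAC.
Qed.

Lemma act_iter_shift f p n H : act f p (iter n shift H) = iter n shift (act f p H).
Proof. by elim: n => //= n <-; rewrite act_shift. Qed.

(* For f = 0 the derivations act coefficientwise. *)
Definition act_coef := act (fun=> 0).

Lemma act_coefM p q H : act_coef (p * q) H = act_coef p (act_coef q H).
Proof. exact: actM. Qed.

Lemma act_coefE p H r : act_coef p H r = lpdo_act p (H r).
Proof.
have phiZ a (w : ser) : coef_at r (@VG_scale F k s (fun=> 0) a w) = a * coef_at r w.
  by [].
apply: (@lpdo_eval_morph F ser F _ _ _ _ _ _ (coef_at r)) => // w.
  rewrite /coef_at /= /series_der big1 ?addr0 // => j _.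
  by rewrite /= raddf0 mul0r.
rewrite /coef_at /= /series_der big1 ?addr0 // => j _.
by rewrite /= raddf0 mul0r.
Qed.

(** The extension of [psi] to polynomials in X, with X sent to [shift]. *)
Definition act_sum (psi : lpdo F -> ser) (Q : {poly lpdo F}) : ser :=
  polysum (fun p i => iter i shift (psi p)) Q.

Definition coefs_in (J : set (lpdo F)) (Q : {poly lpdo F}) := forall i, J Q`_i.

Definition act_hom f (J : set (lpdo F)) (psi : lpdo F -> ser) :=
  [/\ left_ideal J, forall p q, J p -> J q -> psi (p + q) = psi p + psi q
    & forall p q, J q -> psi (p * q) = act f p (psi q)].

Definition act_poly f (Q : {poly lpdo F}) H : ser := act_sum (act f ^~ H) Q.

Lemma act_hom_setT f H : act_hom f setT (act f ^~ H).
Proof.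
by split=> // [p q _ _|p q _]; [rewrite actDl|rewrite actM].
Qed.

Section ActHom.
Variables (f : 'I_k -> F) (J : set (lpdo F)) (psi : lpdo F -> ser).
Hypothesis psiP : act_hom f J psi.
Local Notation sum := (act_sum psi).

Let psi0 : psi 0 = 0.
Proof.
case: psiP => -[J0 _ _] psiD _.
by apply: (addIr (psi 0)); rewrite -psiD ?add0r.
Qed.

Let g0 i : iter i shift (psi 0) = 0. Proof. by rewrite psi0 iter_shift0. Qed.

Lemma act_sumD P Q : coefs_in J P -> coefs_in J Q -> sum (P + Q) = sum P + sum Q.
Proof.
move=> JP JQ; have := size_polyD P Q; set n := maxn _ _ => PQ.
rewrite /act_sum !(@polysum_widen _ _ _ _ n) // ?leq_maxl ?leq_maxr //.
rewrite -big_split; apply: eq_bigr => i _ /=; case: psiP => _ psiD _.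
by rewrite coefD psiD // iter_shiftD.
Qed.

Lemma act_sumC p : sum p%:P = psi p.
Proof. by rewrite /act_sum polysumC. Qed.

Lemma act_sumMX Q : sum (Q * 'X) = shift (sum Q).
Proof. by rewrite /act_sum polysumMX // raddf_sum. Qed.

Lemma act_sumCM p Q : coefs_in J Q -> sum (p%:P * Q) = act f p (sum Q).
Proof.
move=> JQ; rewrite /act_sum (@polysum_widen _ _ _ _ (size Q)) //; last first.
  by rewrite mul_polyC size_scale_leq.
rewrite raddf_sum; apply: eq_bigr => i _ /=; case: psiP => _ _ psiM.
by rewrite coefCM psiM // act_iter_shift.
Qed.

Lemma coefs_inM P Q : coefs_in J Q -> coefs_in J (P * Q).
Proof.
case: psiP => -[J0 JD JM] _ _ JQ i; rewrite coefM.
by apply: (big_ind J) => // l _; exact: JM.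
Qed.

End ActHom.

Section ActPoly.
Variable f : 'I_k -> F.
Implicit Types P Q : {poly lpdo F}.

Lemma act_polyDl P Q H : act_poly f (P + Q) H = act_poly f P H + act_poly f Q H.
Proof. exact: (act_sumD (act_hom_setT f H)). Qed.

Lemma act_polyC p H : act_poly f p%:P H = act f p H.
Proof. exact: (act_sumC (act_hom_setT f H)). Qed.

Lemma act_polyMX Q H : act_poly f (Q * 'X) H = shift (act_poly f Q H).
Proof. exact: (act_sumMX (act_hom_setT f H)). Qed.

Lemma act_polyDr Q H K : act_poly f Q (H + K) = act_poly f Q H + act_poly f Q K.
Proof.
rewrite /act_poly /act_sum /polysum -big_split; apply: eq_bigr => i _ /=.
by rewrite actD iter_shiftD.
Qed.

Lemma act_poly0 Q : act_poly f Q 0 = 0.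
Proof. by apply: (addIr (act_poly f Q 0)); rewrite -act_polyDr !add0r. Qed.

Lemma act_poly0l H : act_poly f 0 H = 0.
Proof. by rewrite /act_poly /act_sum polysum0. Qed.

(** X is central and [shift] commutes with all operators, so linearity of [psi] over F[dx, dy]
    extends to polynomials in X. *)
Lemma act_sumM J psi P Q : act_hom f J psi -> coefs_in J Q ->
  act_sum psi (P * Q) = act_poly f P (act_sum psi Q).
Proof.
move=> psiP JQ; elim/poly_ind: P => [|P p IH].
  by rewrite mul0r act_poly0l /act_sum polysum0.
rewrite mulrDl -mulrA -commr_polyX mulrA act_polyDl act_polyC act_polyMX -IH.
rewrite (act_sumD psiP); last 2 first.
- by move=> i; rewrite coefMX; case: i => [|i] /=;
     [case: psiP => -[]|exact: (coefs_inM psiP)].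
- exact: (coefs_inM psiP).
by rewrite (act_sumMX psiP) (act_sumCM psiP).
Qed.

Lemma act_polyM P Q H : act_poly f (P * Q) H = act_poly f P (act_poly f Q H).
Proof. exact: (act_sumM P (act_hom_setT f H)). Qed.

End ActPoly.
End SeriesAction.

(** * The change of generators of F[dx, dy][X] *)

Section Twist.
Variables (F : pdiffFieldType) (A : nzRingType) (j : {rmorphism lpdo F -> A}) (x : A).
Hypothesis x_central : forall w, x * w = w * x.
Variables (k : nat) (f : 'I_k -> F) (e : 'I_k -> nat).
Implicit Types (a b : F) (w : A) (p q : lpdo F).

Let c a := j (lpdoC a).

Let gxC a : j (Dx F) * c a = c (dx a) + c a * j (Dx F).
Proof. by rewrite /c -!rmorphM lpdo_DxC rmorphD. Qed.
Let gyC a : j (Dy F) * c a = c (dy a) + c a * j (Dy F).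
Proof. by rewrite /c -!rmorphM lpdo_DyC rmorphD. Qed.
Let cC a b : c a * c b = c b * c a.
Proof. by rewrite /c -!rmorphM -!lpdoCM mulrC. Qed.

(** The part of the action of d on V_G that raises exponents, sum (d f_i) X^(e_i), written as an
    element of the ring. *)
Definition twist (d : F -> F) : A := \sum_i j (lpdoC (d (f i))) * x ^+ e i.
(* When [x] is the shift of exponents by 1/q, [untwist_x] and [untwist_y] act on
   V_G as dx and dy applied to the coefficients alone. *)
Definition untwist_x : A := j (Dx F) - twist dx.
Definition untwist_y : A := j (Dy F) - twist dy.

Let xX n w : x ^+ n * w = w * x ^+ n.
Proof.
elim: n => [|n IH]; first by rewrite mul1r mulr1.
by rewrite exprS -mulrA IH mulrA x_central mulrA.
Qed.

Lemma twist_comm d a : twist d * j (lpdoC a) = j (lpdoC a) * twist d.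
Proof.
rewrite /twist mulr_suml mulr_sumr; apply: eq_bigr => i _.
by rewrite -mulrA xX !mulrA cC.
Qed.

Lemma twist_twist d d' : twist d * twist d' = twist d' * twist d.
Proof.
rewrite {1 4}/twist mulr_suml mulr_sumr; apply: eq_bigr => i _.
by rewrite mulrA twist_comm -!mulrA xX.
Qed.

Lemma twist_der d (d' : F -> F) g : (forall a, g * c a = c (d' a) + c a * g) ->
  g * twist d = twist (d' \o d) + twist d * g.
Proof.
move=> gC; rewrite /twist mulr_suml mulr_sumr -big_split; apply: eq_bigr => i _ /=.
by rewrite mulrA gC mulrDl -!mulrA xX.
Qed.

(** Twists commute with each other, and the cross terms leave the difference of the twists by dx dy
    and dy dx, which vanishes as the derivations commute. *)
Lemma untwist_comm : untwist_x * untwist_y = untwist_y * untwist_x.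
Proof.
rewrite /untwist_x /untwist_y !mulrBl !mulrBr -rmorphM lpdo_DxDy rmorphM.
rewrite (twist_der dy gxC) (twist_der dx gyC).
rewrite (twist_twist dx dy) !opprB.
have -> : twist (dx \o dy) = twist (dy \o dx).
  by apply: eq_bigr => i _; rewrite /= dxdyC.
by rewrite !opprD !addrA [LHS]addrAC [RHS]addrAC; congr (_ + _); exact: addrAC.
Qed.

Definition rmorph_scale a w : A := j (lpdoC a) * w.

Lemma untwist_leibniz :
  leibniz_action rmorph_scale ( *%R untwist_x) ( *%R untwist_y).
Proof.
have der (d : F -> F) g : (forall a, g * c a = c (d a) + c a * g) ->
    forall a w, (g - twist d) * rmorph_scale a w =
      rmorph_scale (d a) w + rmorph_scale a ((g - twist d) * w).
  move=> gC a w; rewrite /rmorph_scale !mulrA mulrBl gC twist_comm.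
  by rewrite -addrA -mulrBr mulrDl.
split.
- by move=> a b w; rewrite /rmorph_scale mulrA lpdoCM rmorphM.
- by move=> w; rewrite /rmorph_scale lpdoC1 rmorph1 mul1r.
- by move=> w a b; rewrite /rmorph_scale lpdoCD rmorphD mulrDl.
- by move=> a v w; exact: mulrDr.
- by move=> v w; exact: mulrDr.
- by move=> v w; exact: mulrDr.
- exact: der.
- exact: der.
by move=> w; rewrite !mulrA untwist_comm.
Qed.

(** The ring homomorphism sending dx, dy to [untwist_x], [untwist_y]; it is obtained by acting on 1,
    which the Leibniz rules above make possible. *)
Definition untwist p : A :=
  lpdo_eval rmorph_scale ( *%R untwist_x) ( *%R untwist_y) p 1.

Lemma untwistD p q : untwist (p + q) = untwist p + untwist q.
Proof. exact: (lpdo_evalDl untwist_leibniz). Qed.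

Lemma untwist1 : untwist 1 = 1.
Proof. by rewrite [LHS](lpdo_evalC untwist_leibniz 1) /rmorph_scale rmorph1 mul1r. Qed.

Lemma untwist0 : untwist 0 = 0.
Proof. exact: (lpdo_eval0l untwist_leibniz). Qed.

Lemma untwistC a p : untwist (lpdoC a * p) = j (lpdoC a) * untwist p.
Proof. by rewrite lpdoCE /untwist (lpdo_eval_scale untwist_leibniz). Qed.

Lemma untwist_lpdoC a : untwist (lpdoC a) = j (lpdoC a).
Proof. by rewrite -[lpdoC a in LHS]mulr1 untwistC untwist1 mulr1. Qed.

Lemma untwist_dx p : untwist (Dx F * p) = untwist_x * untwist p.
Proof. by rewrite -lpdo_dxE /untwist (lpdo_eval_dx untwist_leibniz). Qed.

Lemma untwist_dy p : untwist (Dy F * p) = untwist_y * untwist p.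
Proof. by rewrite -lpdo_dyE /untwist (lpdo_eval_dy untwist_leibniz). Qed.

Lemma untwistM p q : untwist (p * q) = untwist p * untwist q.
Proof.
elim/lpdo_ind: p => [|p p' IH IH'|a p IH|p IH|p IH].
- by rewrite untwist1 !mul1r.
- by rewrite mulrDl !untwistD mulrDl IH IH'.
- by rewrite -mulrA !untwistC -mulrA IH.
- by rewrite -mulrA !untwist_dx -mulrA IH.
- by rewrite -mulrA !untwist_dy -mulrA IH.
Qed.

Definition untwist_poly (Q : {poly lpdo F}) : A :=
  polysum (fun p i => untwist p * x ^+ i) Q.

Implicit Types P Q : {poly lpdo F}.

Lemma untwist_polyD P Q : untwist_poly (P + Q) = untwist_poly P + untwist_poly Q.
Proof.
apply: polysumD => [i p q|i]; first by rewrite untwistD mulrDl.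
by rewrite untwist0 mul0r.
Qed.

Lemma untwist_polyMX Q : untwist_poly (Q * 'X) = untwist_poly Q * x.
Proof.
rewrite /untwist_poly polysumMX => [|i]; last by rewrite untwist0 mul0r.
by rewrite mulr_suml; apply: eq_bigr => i _; rewrite exprSr mulrA.
Qed.

Lemma untwist_polyC p : untwist_poly p%:P = untwist p.
Proof.
rewrite /untwist_poly polysumC => [|i]; last by rewrite untwist0 mul0r.
by rewrite mulr1.
Qed.

Lemma untwist_poly0 : untwist_poly 0 = 0.
Proof. exact: polysum0. Qed.

Lemma untwist_polyCM p Q : untwist_poly (p%:P * Q) = untwist p * untwist_poly Q.
Proof.
elim/poly_ind: Q => [|Q q IH]; first by rewrite mulr0 !untwist_poly0 mulr0.
rewrite mulrDr mulrA -polyCM !untwist_polyD !untwist_polyMX !untwist_polyC IH.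
by rewrite untwistM mulrDr mulrA.
Qed.

(** The change of generators can be undone: dx is [untwist_x] plus a twist, and the coefficients of
    a twist lie in F, where [untwist] agrees with [j]. *)
Lemma untwist_poly_surj p : exists Q, untwist_poly Q = j p.
Proof.
have lift d Q : exists R, untwist_poly R = twist d * untwist_poly Q.
  rewrite /twist mulr_suml; apply: (big_ind (fun w => exists R, untwist_poly R = w)).
  - by exists 0; rewrite untwist_poly0.
  - by move=> _ _ [P <-] [R <-]; exists (P + R); rewrite untwist_polyD.
  move=> i _; exists ((lpdoC (d (f i)))%:P * Q * 'X^(e i)).
  have -> n R : untwist_poly (R * 'X^n) = untwist_poly R * x ^+ n.
    elim: n => [|n IH]; rewrite ?mulr1 // !exprSr !mulrA -IH.
    exact: untwist_polyMX.
  by rewrite untwist_polyCM untwist_lpdoC -!mulrA xX.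
elim/lpdo_ind: p => [|p q [P EP] [Q EQ]|a p [Q EQ]|p [Q EQ]|p [Q EQ]].
- by exists 1; rewrite untwist_polyC untwist1 rmorph1.
- by exists (P + Q); rewrite untwist_polyD EP EQ rmorphD.
- by exists ((lpdoC a)%:P * Q); rewrite untwist_polyCM EQ untwist_lpdoC rmorphM.
- have [R ER] := lift dx Q; exists ((Dx F)%:P * Q + R).
  rewrite untwist_polyD untwist_polyCM ER -[Dx F]mulr1 untwist_dx untwist1 !mulr1.
  by rewrite -mulrDl /untwist_x subrK EQ rmorphM.
have [R ER] := lift dy Q; exists ((Dy F)%:P * Q + R).
rewrite untwist_polyD untwist_polyCM ER -[Dy F]mulr1 untwist_dy untwist1 !mulr1.
by rewrite -mulrDl /untwist_y subrK EQ rmorphM.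
Qed.

End Twist.

Definition polyC_lpdo (F : pdiffFieldType) : {rmorphism lpdo F -> {poly lpdo F}} :=
  @polyC (lpdo F).

Lemma polyC_lpdoE (F : pdiffFieldType) (p : lpdo F) : polyC_lpdo F p = p%:P.
Proof. by []. Qed.

(** * Reduction of the action on V_G to the coefficientwise one *)

Section Untwisted.
Variables (F : pdiffFieldType) (k : nat) (s : 'I_k -> rat) (f : 'I_k -> F).
Hypothesis s_pos : forall i, 0 < s i.
Local Notation ser := (frac_ser F s).
Local Notation step := ((common_denom s)%:R^-1 : rat).
Implicit Types (p : lpdo F) (Q : {poly lpdo F}) (H : ser).

Definition exponent j : nat := Num.truncn (s j * (common_denom s)%:R).

(** No rounding occurs: q s_j is an integer, and it is nonnegative since s_j > 0. *)
Lemma exponentP j : (exponent j)%:R * step = s j.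
Proof.
have q0 : (common_denom s)%:R != 0 :> rat by rewrite pnatr_eq0 -lt0n common_denom_gt0.
rewrite /exponent truncnK ?mulfK // natrEint common_denom_int /=.
by rewrite mulr_ge0 ?ler0n ?ltW.
Qed.

Lemma polyX_central (w : {poly lpdo F}) : 'X * w = w * 'X.
Proof. by rewrite commr_polyX. Qed.

Definition polyX_untwist p : {poly lpdo F} := untwist (polyC_lpdo F) 'X f exponent p.
Definition polyX_untwist_poly Q : {poly lpdo F} :=
  untwist_poly (polyC_lpdo F) 'X f exponent Q.
Local Notation untw := polyX_untwist.
Local Notation untw_poly := polyX_untwist_poly.

Lemma untw1 : untw 1 = 1%:P.
Proof. exact: (untwist1 _ polyX_central). Qed.
Lemma untwD p q : untw (p + q) = untw p + untw q.
Proof. exact: (untwistD _ polyX_central). Qed.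
Lemma untwC a p : untw (lpdoC a * p) = (lpdoC a)%:P * untw p.
Proof. exact: (untwistC _ polyX_central). Qed.
Lemma untw_dx p : (Dx F)%:P * untw p =
  untw (Dx F * p) + twist (polyC_lpdo F) 'X f exponent dx * untw p.
Proof.
rewrite {2}/untw (untwist_dx _ polyX_central) -mulrDl /untwist_x subrK.
by [].
Qed.
Lemma untw_dy p : (Dy F)%:P * untw p =
  untw (Dy F * p) + twist (polyC_lpdo F) 'X f exponent dy * untw p.
Proof.
rewrite {2}/untw (untwist_dy _ polyX_central) -mulrDl /untwist_y subrK.
by [].
Qed.
Lemma untw_polyD P Q : untw_poly (P + Q) = untw_poly P + untw_poly Q.
Proof. exact: (untwist_polyD _ polyX_central). Qed.
Lemma untw_poly0 : untw_poly 0 = 0.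
Proof. exact: untwist_poly0. Qed.
Lemma untw_polyMX Q : untw_poly (Q * 'X) = untw_poly Q * 'X.
Proof. exact: (untwist_polyMX _ polyX_central). Qed.
Lemma untw_polyCM p Q : untw_poly (p%:P * Q) = untw p * untw_poly Q.
Proof. exact: (untwist_polyCM _ polyX_central). Qed.
Lemma untw_polyC p : untw_poly p%:P = untw p.
Proof. exact: (untwist_polyC _ polyX_central). Qed.
Lemma untw_poly_surj p : exists Q, untw_poly Q = p%:P.
Proof. exact: (untwist_poly_surj _ polyX_central). Qed.

Lemma act_poly_twist (d : F -> F) H r :
  act_poly f (twist (polyC_lpdo F) 'X f exponent d) H r =
  \sum_j d (f j) * H (r - s j).
Proof.
have MXn n Q : act_poly f (Q * 'X^n) H = iter n (@shift F k s) (act_poly f Q H).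
  elim: n => [|n IH]; first by rewrite mulr1.
  by rewrite exprSr mulrA act_polyMX IH.
rewrite /twist (big_morph (fun Q => act_poly f Q H) (fun P Q => act_polyDl f P Q H)
  (act_poly0l f H)).
rewrite -/(coef_at r _) raddf_sum; apply: eq_bigr => j _.
by rewrite MXn polyC_lpdoE act_polyC /= /coef_at iter_shiftE actC exponentP.
Qed.

(** On V_G, dx is its coefficientwise action plus the twist, so subtracting the twist leaves the
    former; likewise for dy. *)
Lemma act_untwist p H : act_poly f (untw p) H = act_coef p H.
Proof.
elim/lpdo_ind: p H => [|p q IHp IHq|a p IH|p IH|p IH] H.
- by rewrite untw1 act_polyC /act_coef !act1.
- by rewrite untwD act_polyDl IHp IHq /act_coef actDl.
- rewrite untwC act_polyM IH act_polyC /act_coef actM.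
  by apply: ser_ext => r; rewrite !actC.
- apply: ser_ext => r; rewrite act_coefM -{}IH.
  have E : act f (Dx F) (act_poly f (untw p) H) = act_poly f (untw (Dx F * p)) H +
    act_poly f (twist (polyC_lpdo F) 'X f exponent dx) (act_poly f (untw p) H).
    by rewrite -act_polyC -!act_polyM untw_dx act_polyDl.
  apply: (addIr (\sum_j dx (f j) * act_poly f (untw p) H (r - s j))).
  by rewrite -{1}act_poly_twist -serD -E act_dx act_coefE lpdo_act_dx.
apply: ser_ext => r; rewrite act_coefM -{}IH.
have E : act f (Dy F) (act_poly f (untw p) H) = act_poly f (untw (Dy F * p)) H +
  act_poly f (twist (polyC_lpdo F) 'X f exponent dy) (act_poly f (untw p) H).
  by rewrite -act_polyC -!act_polyM untw_dy act_polyDl.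
apply: (addIr (\sum_j dy (f j) * act_poly f (untw p) H (r - s j))).
by rewrite -{1}act_poly_twist -serD -E act_dy act_coefE lpdo_act_dy.
Qed.

Lemma act_untwist_poly Q H : act_poly f (untw_poly Q) H = act_poly (fun=> 0) Q H.
Proof.
elim/poly_ind: Q => [|Q p IH]; first by rewrite untw_poly0 !act_poly0l.
rewrite untw_polyD untw_polyMX untw_polyC.
by rewrite !act_polyDl !act_polyMX IH act_untwist act_polyC.
Qed.

End Untwisted.

(** * Solving linear systems for the coefficientwise action *)

Section CoefficientwiseSolve.
Variables (F : pdiffFieldType) (k : nat) (s : 'I_k -> rat).
Local Notation ser := (frac_ser F s).
Local Notation step := ((common_denom s)%:R^-1 : rat).
Local Notation coef_poly := (act_poly (fun=> 0)).
Implicit Types (p : lpdo F) (P Q : {poly lpdo F}) (H K : ser) (b r : rat).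

Definition below b H := forall r, b < r -> H r = 0.

Lemma below_le b b' H : b <= b' -> below b H -> below b' H.
Proof. by move=> bb' Hb r /(le_lt_trans bb')/Hb. Qed.

Lemma belowD b H K : below b H -> below b K -> below b (H + K).
Proof. by move=> Hb Kb r br; rewrite serD Hb // Kb // addr0. Qed.

Lemma below_act b p H : below b H -> below b (act_coef p H).
Proof. by move=> Hb r br; rewrite act_coefE Hb // lpdo_act0. Qed.

Lemma below_shift b H : below b H -> below (b + step) (shift H).
Proof. by move=> Hb r br; rewrite shiftE Hb // ltrBrDr. Qed.

Lemma below_ex H : exists b, below b H.
Proof.
have [_ [b Hb]] := frac_seriesP _ _ (valP H); exists b => r br.
by apply/eqP; apply: contraTT br => /Hb; rewrite leNgt.
Qed.

Lemma coef_polyE n Q H r : (size Q <= n)%N ->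
  coef_poly Q H r = \sum_(i < n) lpdo_act Q`_i (H (r - i%:R * step)).
Proof.
move=> Qn; rewrite -/(coef_at r _) /act_poly /act_sum (@polysum_widen _ _ _ _ n) //.
  rewrite raddf_sum; apply: eq_bigr => i _.
  by rewrite /= /coef_at iter_shiftE -act_coefE.
by move=> i; rewrite act0 iter_shift0.
Qed.

(* [Psi] is linear over the polynomials in 'X with coefficients in F[dx, dy],
   where F[dx, dy] acts on series coefficientwise and 'X by [shift]. *)
Record poly_hom (I : set {poly lpdo F}) (Psi : {poly lpdo F} -> ser) : Prop := PolyHom {
  poly_hom0 : I 0;
  poly_homD : forall P Q, I P -> I Q -> I (P + Q);
  poly_homC : forall p Q, I Q -> I (p%:P * Q);
  poly_homX : forall Q, I Q -> I (Q * 'X);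
  poly_hom_mapD : forall P Q, I P -> I Q -> Psi (P + Q) = Psi P + Psi Q;
  poly_hom_mapC : forall p Q, I Q -> Psi (p%:P * Q) = act_coef p (Psi Q);
  poly_hom_mapX : forall Q, I Q -> Psi (Q * 'X) = shift (Psi Q)
}.

Section PolyHom.
Variables (I : set {poly lpdo F}) (Psi : {poly lpdo F} -> ser).
Hypothesis IP : poly_hom I Psi.

Lemma poly_homB P Q : I P -> I Q -> I (P - Q).
Proof.
move=> Pi Qi; apply: (poly_homD IP) => //.
by rewrite -mulN1r -polyC1 -polyCN; exact: (poly_homC IP).
Qed.

Lemma poly_hom_split P Q : I P -> I Q -> Psi P = Psi (P - Q) + Psi Q.
Proof.
by move=> Pi Qi; rewrite -(poly_hom_mapD IP) ?subrK //; exact: poly_homB.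
Qed.

Lemma poly_hom_map0 : Psi 0 = 0.
Proof.
by apply: (addIr (Psi 0)); rewrite -(poly_hom_mapD IP) ?add0r //; exact: (poly_hom0 IP).
Qed.

(** The bound [b] filters [lead_ideal n] by left ideals; noetherianity makes this filtration stop at
    a finite [b]. *)
Definition lead_coefs n b : set (lpdo F) :=
  [set p | exists Q, [/\ I Q, (size Q <= n.+1)%N, Q`_n = p & below b (Psi Q)]].

Definition lead_ideal n : set (lpdo F) :=
  [set p | exists Q, [/\ I Q, (size Q <= n.+1)%N & Q`_n = p]].

Lemma lead_coefs_submod n b : submodule setT (lead_coefs n b).
Proof.
split; first exists 0.
- by split; rewrite ?size_poly0 ?coef0 ?poly_hom_map0 //; exact: (poly_hom0 IP).
- move=> _ _ [P [Pi Pn <- Pb]] [Q [Qi Qn <- Qb]]; exists (P + Q).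
  split; rewrite ?coefD //; first exact: (poly_homD IP).
    by rewrite (leq_trans (size_polyD _ _)) // geq_max Pn.
  by rewrite (poly_hom_mapD IP) //; exact: belowD.
move=> p _ _ [Q [Qi Qn <- Qb]]; exists (p%:P * Q); split; rewrite ?coefCM //.
- exact: (poly_homC IP).
- by rewrite mul_polyC (leq_trans (size_scale_leq _ _)).
by rewrite (poly_hom_mapC IP) //; exact: below_act.
Qed.

Lemma lead_ideal_ex n p : lead_ideal n p -> exists b, lead_coefs n b p.
Proof. by move=> [Q [Qi Qn Qp]]; have [b] := below_ex (Psi Q); exists b, Q. Qed.

Lemma lead_coefs_ideal n b : lead_coefs n b `<=` lead_ideal n.
Proof. by move=> p [Q [Qi Qn Qp _]]; exists Q. Qed.

Lemma lead_coefs_le n b b' : b <= b' -> lead_coefs n b `<=` lead_coefs n b'.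
Proof.
by move=> bb' p [Q [Qi Qn Qp Qb]]; exists Q; split=> //; exact: below_le Qb.
Qed.

Lemma lead_coefsS n m b : (n <= m)%N ->
  lead_coefs n b `<=` lead_coefs m (b + (m - n)%:R * step).
Proof.
move=> /subnK {1}<-; elim: (m - n)%N => [|d IH] p; first by rewrite mul0r addr0.
move=> /IH[Q [Qi Qn Qp Qb]]; exists (Q * 'X); split.
- exact: (poly_homX IP).
- have [->|Q0] := eqVneq Q 0; first by rewrite mul0r size_poly0.
  by rewrite size_mulX // addSn ltnS.
- by rewrite coefMX.
rewrite (poly_hom_mapX IP) // -addn1 natrD mulrDl mul1r addrA.
exact: below_shift.
Qed.

Lemma lead_idealS n m : (n <= m)%N -> lead_ideal n `<=` lead_ideal m.
Proof.
by move=> nm p /lead_ideal_ex[b /(lead_coefsS nm)]; exact: lead_coefs_ideal.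
Qed.

Lemma lead_idealP n : left_ideal (lead_ideal n).
Proof.
have up p q : lead_ideal n p -> lead_ideal n q ->
    exists b, lead_coefs n b p /\ lead_coefs n b q.
  move=> /lead_ideal_ex[b pb] /lead_ideal_ex[c qc]; exists (Num.max b c).
  by split; [move: pb|move: qc]; apply: lead_coefs_le; rewrite le_max lexx ?orbT.
split.
- by apply: (@lead_coefs_ideal n 0); case: (lead_coefs_submod n 0).
- move=> p q np nq; have [b [pb qb]] := up p q np nq.
  by apply: (@lead_coefs_ideal n b); case: (lead_coefs_submod n b) => _ D _; exact: D.
move=> p q nq; have [b [_ qb]] := up q q nq nq.
by apply: (@lead_coefs_ideal n b); case: (lead_coefs_submod n b) => _ _; exact.
Qed.

Lemma lead_ideal_bounded n : exists b, lead_ideal n `<=` lead_coefs n b.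
Proof.
have [g [gn gen]] := lpdo_noetherian (lead_idealP n).
suff [b gb] : exists b, forall p, p \in g -> lead_coefs n b p.
  by exists b; apply: gen => //; exact: lead_coefs_submod.
elim: g gn {gen} => [|p g IH] gn; first by exists 0.
have [|b gb] := IH; first by move=> q qg; apply: gn; rewrite inE qg orbT.
have [c pc] := lead_ideal_ex (gn p (mem_head _ _)).
exists (Num.max b c) => q; rewrite inE => /predU1P[->|/gb].
  by move: pc; apply: lead_coefs_le; rewrite le_max lexx orbT.
by apply: lead_coefs_le; rewrite le_max lexx.
Qed.

Definition all_leads : set (lpdo F) := [set p | exists n, lead_ideal n p].

Lemma all_leads_ideal : left_ideal all_leads.
Proof.
split; first by exists 0%N; case: (lead_idealP 0).
  move=> p q [n np] [m mq]; exists (maxn n m).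
  case: (lead_idealP (maxn n m)) => _ D _; apply: D.
    by move: np; apply: lead_idealS; rewrite leq_maxl.
  by move: mq; apply: lead_idealS; rewrite leq_maxr.
by move=> p q [n nq]; exists n; case: (lead_idealP n) => _ _; exact.
Qed.

Lemma lead_ideal_stable : exists N, forall n, lead_ideal n `<=` lead_ideal N.
Proof.
have [g [gL gen]] := lpdo_noetherian all_leads_ideal.
suff [N gN] : exists N, forall p, p \in g -> lead_ideal N p.
  exists N => n p np; apply: (gen (lead_ideal N)) => //; last by exists n.
  by case: (lead_idealP N) => N0 ND NM; split=> // r a _; exact: NM.
elim: g gL {gen} => [|p g IH] gL; first by exists 0%N.
have [|N gN] := IH; first by move=> q qg; apply: gL; rewrite inE qg orbT.
have [n pn] := gL p (mem_head _ _).
exists (maxn n N) => q; rewrite inE => /predU1P[->|/gN].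
  by move: pn; apply: lead_idealS; rewrite leq_maxl.
by apply: lead_idealS; rewrite leq_maxr.
Qed.

(* Subtracting the element of [lead_coefs] with the same leading coefficient. *)
Lemma below_reduce n b c Q : I Q -> (size Q <= n.+1)%N -> lead_coefs n b Q`_n ->
  (forall R, I R -> (size R <= n)%N -> below c (Psi R)) -> c <= b -> below b (Psi Q).
Proof.
move=> Qi Qn [R [Ri Rn RQ Rb]] lower cb; rewrite (poly_hom_split Qi Ri).
apply: belowD => //; apply: (below_le cb); apply: lower; first exact: poly_homB.
apply/leq_sizeP => j; rewrite leq_eqVlt => /predU1P[<-|nj].
  by rewrite coefB RQ subrr.
by rewrite coefB !nth_default ?subrr // (leq_trans _ nj).
Qed.

(** Degrees up to the stable degree [N] are bounded one at a time. In degree n > N the leading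
    coefficient is already attained in degree [N] with bound [c]; multiplying by X^(n - N) raises
    the bound by (n - N)/q, and the remainder has smaller degree. *)
Lemma poly_hom_bounded : exists b, forall n Q, I Q -> (size Q <= n.+1)%N ->
  below (b + n%:R * step) (Psi Q).
Proof.
have low n : exists b, forall Q, I Q -> (size Q <= n)%N -> below b (Psi Q).
  elim: n => [|n [b IH]].
    exists 0 => Q _; rewrite leqn0 size_poly_eq0 => /eqP-> r _.
    by rewrite poly_hom_map0.
  have [c lc] := lead_ideal_bounded n; exists (Num.max b c) => Q Qi Qn.
  apply: (below_reduce Qi Qn _ IH); last by rewrite le_max lexx.
  by apply: (@lead_coefs_le _ c); rewrite ?le_max ?lexx ?orbT //; apply: lc; exists Q.
have [N stable] := lead_ideal_stable.
have [b lowb] := low N.+1; have [c lc] := lead_ideal_bounded N.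
exists (Num.max b c); set d := Num.max b c.
have step_ge0 := ltW (step_gt0 s).
have dn n : d <= d + n%:R * step by rewrite lerDl mulr_ge0.
elim=> [|n IH] Q Qi Qn.
  apply: (@below_le b); last by apply: lowb => //; exact: leq_trans Qn _.
  by rewrite (le_trans _ (dn _)) // le_max lexx.
have [nN|Nn] := leqP n.+1 N.
  apply: (@below_le b); last by apply: lowb => //; exact: leq_trans Qn _.
  by rewrite (le_trans _ (dn _)) // le_max lexx.
apply: (below_reduce Qi Qn _ IH); last by rewrite lerD2l ler_wpM2r // ler_nat.
apply: (@lead_coefs_le _ (c + (n.+1 - N)%:R * step)).
  by rewrite lerD ?le_max ?lexx ?orbT // ler_wpM2r // ler_nat leq_subr.
by apply: lead_coefsS; [exact: ltnW|apply/lc/(stable n.+1); exists Q].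
Qed.

Hypotheses (charF : [pchar F] =i pred0) (closedF : differentially_closed F).

Definition monomial b (h : F) (bZ : b * (common_denom s)%:R \is a Num.int) : ser :=
  FracSer (monomial_closed h bZ).
Arguments monomial : simpl never.

(** The coefficient of [Psi Q] at the extreme exponent depends only on the coefficient of X^n in Q
    and is linear in it. Injectivity of F yields [h] representing this map, and removing the
    contribution of h G^{(b)} lowers the bound by one step. *)
Lemma poly_hom_lead b (bZ : b * (common_denom s)%:R \is a Num.int) :
  (forall n Q, I Q -> (size Q <= n.+1)%N -> below (b + n%:R * step) (Psi Q)) ->
  exists h, forall n Q, I Q -> (size Q <= n.+1)%N ->
    below (b - step + n%:R * step) (Psi Q - coef_poly Q (monomial h bZ)).
Proof.
move=> bPsi; have step0 := step_gt0 s.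
have qV : step * (common_denom s)%:R = 1.
  by rewrite mulVf // pnatr_eq0 -lt0n common_denom_gt0.
pose top n Q : F := Psi Q (b + n%:R * step).
have topS n Q : I Q -> top n.+1 (Q * 'X) = top n Q.
  move=> Qi; rewrite /top (poly_hom_mapX IP) // shiftE -addn1 natrD mulrDl mul1r.
  by rewrite addrA addrK.
(* Polynomials of different degrees are compared after multiplication by powers of X. *)
have shiftQ d n Q : I Q -> (size Q <= n.+1)%N -> exists R,
    [/\ I R, (size R <= (n + d).+1)%N, R`_(n + d) = Q`_n & top (n + d)%N R = top n Q].
  move=> Qi Qn; elim: d => [|d [R [Ri Rn RQ Rt]]]; first by exists Q; rewrite addn0.
  exists (R * 'X); rewrite addnS coefMX topS //; split=> //.
    exact: (poly_homX IP).
  have [->|R0] := eqVneq R 0; first by rewrite mul0r size_poly0.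
  by rewrite size_mulX.
(* With equal leading coefficients in degree l, the difference has degree below l, so its image
   stays strictly under the exponent b + l/q; for l = 0 the difference is zero. *)
have top_uniq n m P Q : I P -> I Q -> (size P <= n.+1)%N -> (size Q <= m.+1)%N ->
    P`_n = Q`_m -> top n P = top m Q.
  move=> Pi Qi Pn Qm PQ.
  have [P' [P'i P'n P'P P't]] := shiftQ m n P Pi Pn.
  have [Q' [Q'i Q'n Q'Q Q't]] := shiftQ n m Q Qi Qm.
  rewrite -P't -Q't addnC /top (poly_hom_split P'i Q'i) serD.
  move: P'n P'P Q'n Q'Q; rewrite (addnC n m); set l := (m + n)%N => P'l P'P Q'l Q'Q.
  have R0 : (P' - Q')`_l = 0 by rewrite coefB P'P Q'Q PQ subrr.
  have Rl : (size (P' - Q')%R <= l)%N.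
    apply/leq_sizeP => j; rewrite leq_eqVlt => /predU1P[<-//|lj].
    by rewrite coefB !nth_default ?subrr // (leq_trans _ lj).
  have Ri := poly_homB P'i Q'i.
  case: (l) Rl => [|l'] Rl.
    by move: Rl; rewrite leqn0 size_poly_eq0 => /eqP->; rewrite poly_hom_map0 add0r.
  rewrite (bPsi l' _ Ri Rl) ?add0r // ltrD2l ltr_pM2r // ltr_nat.
  exact: ltnSn.
have /choice[psi psiP] p : exists v, forall n Q, I Q -> (size Q <= n.+1)%N ->
    Q`_n = p -> top n Q = v.
  have [[n [Q [Qi Qn Qp]]]|nL] := pselect (all_leads p).
    by exists (top n Q) => m R Ri Rm Rp; apply: top_uniq; rewrite ?Rp ?Qp.
  by exists 0 => m R Ri Rm Rp; case: nL; exists m, R.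
have [||h hP] := @field_injective F charF closedF all_leads psi all_leads_ideal.
- move=> p q [n np] [m mq].
  have [P [Pi Pn Pp]] : lead_ideal (maxn n m) p.
    by move: np; apply: lead_idealS; rewrite leq_maxl.
  have [Q [Qi Qn Qq]] : lead_ideal (maxn n m) q.
    by move: mq; apply: lead_idealS; rewrite leq_maxr.
  rewrite -(psiP p _ P Pi Pn Pp) -(psiP q _ Q Qi Qn Qq).
  rewrite -(psiP _ (maxn n m) (P + Q)) ?coefD ?Pp ?Qq //.
  + by rewrite /top (poly_hom_mapD IP).
  + exact: (poly_homD IP).
  by rewrite (leq_trans (size_polyD _ _)) // geq_max Pn.
- move=> p q [n [Q [Qi Qn Qq]]].
  rewrite -(psiP q _ Q Qi Qn Qq) -(psiP _ n (p%:P * Q)) ?coefCM ?Qq //.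
  + by rewrite /top (poly_hom_mapC IP) // act_coefE.
  + exact: (poly_homC IP).
  by rewrite mul_polyC (leq_trans (size_scale_leq _ _)).
exists h => n Q Qi Qn r br.
have monoE x : monomial h bZ x = if x == b then h else 0 by [].
have [rb|rb|->] := ltgtP r (b + n%:R * step).
(* Exponents lie in (1/q)Z, and no such number is strictly between b + (n - 1)/q and b + n/q. *)
- set R := Psi Q - _; rewrite -[LHS]/(R r).
  apply/eqP/negPn/negP => Rr; have [RZ _] := frac_seriesP _ _ (valP R).
  have /intrP[z rz] := RZ r Rr; have /intrP[y by_] := bZ.
  have q0 : 0 < (common_denom s)%:R :> rat by rewrite ltr0n common_denom_gt0.
  rewrite -(ltr_pM2r q0) in br; rewrite -(ltr_pM2r q0) in rb.
  move: br rb; rewrite !mulrDl mulNr -!mulrA qV mulr1 rz by_.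
  rewrite -[n%:R]/((n%:Z)%:~R) -[1]/(1%:~R) -!rmorphN -!rmorphD !ltr_int.
  lia.
- rewrite serB (bPsi n Q Qi Qn r rb) (@coef_polyE n.+1) // sub0r big1 ?oppr0 // => i _.
  rewrite monoE ifN ?lpdo_act0 // gt_eqF // ltrBrDr (le_lt_trans _ rb) //.
  by rewrite lerD2l ler_pM2r // ler_nat -ltnS.
(* At the extreme exponent only the coefficient of X^n in Q meets the monomial. *)
rewrite serB (@coef_polyE n.+1) // big_ord_recr /= addrK eqxx big1 => [|i _].
  rewrite add0r -[Psi Q _]/(top n Q) (psiP _ n Q Qi Qn (erefl _)) hP ?subrr //.
  by exists n, Q.
rewrite ifN ?lpdo_act0 // gt_eqF // ltrBrDr ltrD2l ltr_pM2r //.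
by rewrite ltr_nat.
Qed.

End PolyHom.

Lemma poly_hom_sub I Psi H : poly_hom I Psi ->
  poly_hom I (fun Q => Psi Q - coef_poly Q H).
Proof.
case=> I0 ID IC IX PD PC PX; split=> // [P Q Pi Qi|p Q Qi|Q Qi].
- by rewrite PD // act_polyDl opprD addrACA.
- by rewrite PC // act_polyM act_polyC /act_coef raddfB.
by rewrite PX // act_polyMX raddfB.
Qed.

Lemma poly_hom_solve I Psi (charF : [pchar F] =i pred0)
    (closedF : differentially_closed F) :
  poly_hom I Psi -> exists H, forall Q, I Q -> Psi Q = coef_poly Q H.
Proof.
move=> IP; have step0 := step_gt0 s; have [b0 b0P] := poly_hom_bounded IP.
have q0 : 0 < (common_denom s)%:R :> rat by rewrite ltr0n common_denom_gt0.
(* An integer above [b0], so that every [bd m] is an admissible exponent. *)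
pose b : rat := (Num.truncn b0).+1%:R; pose bd m : rat := b - m%:R * step.
have bdZ m : bd m * (common_denom s)%:R \is a Num.int.
  by rewrite mulrBl divfK ?gt_eqF // rpredB ?rpredM ?natr_int.
have bdS m : bd m.+1 = bd m - step by rewrite /bd -addn1 natrD mulrDl mul1r opprD addrA.
have bd_le m d : bd (m + d)%N <= bd m.
  by rewrite lerD2l lerN2 ler_pM2r // ler_nat leq_addr.
pose good m H := forall n Q, I Q -> (size Q <= n.+1)%N ->
  below (bd m + n%:R * step) (Psi Q - coef_poly Q H).
(* The correction at stage m is a single monomial at [bd m]; later stages leave the higher exponents
   untouched. *)
have /choice[next nextP] (mH : nat * ser) : exists K, good mH.1 mH.2 ->
    good mH.1.+1 (mH.2 + K) /\ forall r, r != bd mH.1 -> K r = 0.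
  case: mH => m H; have [gH|ngH] := pselect (good m H); last by exists 0.
  have [h hP] := poly_hom_lead (poly_hom_sub H IP) charF closedF (bdZ m) gH.
  exists (monomial h (bdZ m)) => _; split=> [n Q Qi Qn|r rm].
    by rewrite act_polyDr opprD addrA bdS; exact: hP.
  by rewrite /= ifN.
pose fix Hs m : ser := if m is m'.+1 then Hs m' + next (m', Hs m') else 0.
have Hs_good m : good m (Hs m).
  elim: m => [|m IH] n Q Qi Qn; last by have [+ _] := nextP (m, Hs m) IH; exact.
  rewrite act_poly0 subr0; apply: (below_le _ (b0P n Q Qi Qn)).
  by rewrite lerD2r /bd mul0r subr0 ltW // truncnS_gt.
have Hs_stable m d r : bd m < r -> Hs (m + d)%N r = Hs m r.
  move=> mr; elim: d => [|d IH]; first by rewrite addn0.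
  rewrite addnS -[Hs _]/(Hs (m + d)%N + next ((m + d)%N, Hs (m + d)%N)) serD IH.
  have [_ Kr] := nextP ((m + d)%N, Hs (m + d)%N) (Hs_good (m + d)%N).
  by rewrite Kr ?addr0 //= gt_eqF // (le_lt_trans (bd_le _ _)).
(* A stage from which the coefficient at r no longer changes. *)
pose ord r := (Num.truncn ((b - r) * (common_denom s)%:R)).+1.
have ordP r : bd (ord r) < r.
  rewrite /bd ltrBlDr -ltrBlDl ltr_pdivlMr //; exact: truncnS_gt.
have Hlim_eq m r : bd m < r -> Hs (ord r) r = Hs m r.
  by move=> mr; rewrite -(Hs_stable _ m) // addnC Hs_stable.
have Hlim : (fun r => Hs (ord r) r) \in @frac_series F k s.
  apply/frac_seriesP; split=> [r|].
    by have [HZ _] := frac_seriesP _ _ (valP (Hs (ord r))); exact: HZ.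
  exists b => r; apply: contraNT; rewrite -ltNge => br; apply/eqP.
  by rewrite (Hlim_eq 0%N) // /bd mul0r subr0.
exists (FracSer Hlim) => Q Qi; apply: ser_ext => r.
(* The coefficient of Q H at r involves H only down to r - n/q; the n extra stages bring the error
   bound bd m + n/q to [bd (ord r)], below r. *)
set n := size Q; set m := (ord r + n)%N.
have mr : bd m + n%:R * step < r.
  by rewrite /bd /m natrD mulrDl opprD addrA subrK ordP.
have := Hs_good m n Q Qi (leqnSn _) r mr; rewrite serB => /eqP.
rewrite subr_eq0 => /eqP->; rewrite !(@coef_polyE n) //; apply: eq_bigr => i _.
congr lpdo_act; apply/esym/Hlim_eq; rewrite ltrBrDr (le_lt_trans _ mr) //.
by rewrite lerD2l ler_pM2r // ler_nat ltnW.
Qed.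

End CoefficientwiseSolve.

(** * Injectivity of V_G *)

Section Injective.
Variables (F : pdiffFieldType) (k : nat) (s : 'I_k -> rat) (f : 'I_k -> F).
Hypotheses (charF : [pchar F] =i pred0) (closedF : differentially_closed F).
Hypothesis s_pos : forall i, 0 < s i.
Local Notation ser := (frac_ser F s).
Local Notation untw_poly := (polyX_untwist_poly s f).

Lemma VG_injective (J : set (lpdo F)) (psi : lpdo F -> ser) :
  act_hom f J psi -> exists H, forall p, J p -> psi p = act f p H.
Proof.
move=> psiP; have [[J0 JD JM] psiD psiM] := psiP.
have cD P Q : coefs_in J P -> coefs_in J Q -> coefs_in J (P + Q).
  by move=> JP JQ i; rewrite coefD; exact: JD.
have cX Q : coefs_in J Q -> coefs_in J (Q * 'X).
  by move=> JQ i; rewrite coefMX; case: eqP.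
(* The preimage of J[X] under the change of generators; transported there, [psi] is linear for the
   coefficientwise action. *)
pose I : set {poly lpdo F} := [set Q | coefs_in J (untw_poly Q)].
pose Psi Q : ser := act_sum psi (untw_poly Q).
have IP : poly_hom I Psi.
  split=> [|P Q Pi Qi|p Q Qi|Q Qi|P Q Pi Qi|p Q Qi|Q Qi].
  - by move=> i; rewrite untw_poly0 coef0.
  - by rewrite /I /= untw_polyD; exact: cD.
  - by rewrite /I /= untw_polyCM; exact: (coefs_inM psiP).
  - by rewrite /I /= untw_polyMX; exact: cX.
  - by rewrite /Psi untw_polyD (act_sumD psiP).
  - by rewrite /Psi untw_polyCM (act_sumM _ psiP) // act_untwist.
  by rewrite /Psi untw_polyMX (act_sumMX psiP).
have [H HP] := poly_hom_solve charF closedF IP.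
exists H => p Jp; have [Q QE] := untw_poly_surj s f p.
have Qi : I Q by rewrite /I /= QE => i; rewrite coefC; case: eqP.
have := HP Q Qi; rewrite -(act_untwist_poly f s_pos) /Psi QE act_polyC => <-.
by rewrite (act_sumC psiP).
Qed.

End Injective.

(** * The first isomorphism theorem *)

Section QuotientIsomorphism.
Variables (K : pzRingType) (V U : lmodType K) (W : submodClosed V).
Variable phi : {linear V -> U}.

Lemma lquot_isomorphic : (forall v, phi v = 0 <-> v \in W) ->
  (forall u, exists v, phi v = u) -> isomorphic (lquot W) U.
Proof.
move=> ker surj.
have piP x : exists v, x = lquot_pi W v by exact: lquot_pi_surj.
pose h (x : lquot W) : U := phi (sval (cid (piP x))).
have hE v : h (lquot_pi W v) = phi v.
  rewrite /h; case: cid => v' /= /eqP; rewrite lquot_piE => vv'.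
  by apply/esym/eqP; rewrite -subr_eq0 -raddfB; apply/eqP/ker.
have hlin : linear h.
  move=> a x y; have [[u ->] [v ->]] := (piP x, piP y).
  by rewrite [a *: _]lquot_piZ -lquot_piD !hE linearP.
pose hL : {linear lquot W -> U} := HB.pack h (GRing.isLinear.Build _ _ _ _ h hlin).
exists hL; have /choice[g gP] := surj.
exists (fun u => lquot_pi W (g u)) => [x|u]; last by rewrite /= hE.
have [v ->] := piP x; rewrite /= hE; apply/eqP; rewrite lquot_piE.
by apply/ker; rewrite raddfB /= gP subrr.
Qed.

End QuotientIsomorphism.

(** * The isomorphism induced by H |-> (p_i H)_i *)

Theorem proposition5p5 (F : pdiffFieldType)
    (charF0 : [pchar F] =i pred0)
    (closedF : differentially_closed F)
    (universalF : kolchin_universal F)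
    (t : nat) (J J1 : set (lpdo F)) (p : 'I_t -> lpdo F)
    (idealJ : left_ideal J) (idealJ1 : left_ideal J1)
    (JJ1 : J `<=` J1)
    (typeJ : differential_type J 1) (typeJ1 : differential_type J1 1)
    (genJ1 : J1 = left_ideal_gen p)
    (* k = n.+1; the exponent 1 of the term (df_1) G^{(1+s)} is [s ord0] *)
    (n : nat) (s : 'I_n.+1 -> rat) (f : 'I_n.+1 -> F)
    (s_first : s ord0 = 1)
    (s_decr : forall i j : 'I_n.+1, (i < j)%N -> s j < s i)
    (s_pos : forall i : 'I_n.+1, 0 < s i)
    (grad_f1 : (dx (f ord0), dy (f ord0)) != (0, 0)) :
  isomorphic (VG_sol_quotient s f J J1) (VG_sys_sol s f (Syz J p)).
Proof.
set V := VG s f; have [J0 JD JM] := idealJ; have [_ J1D J1M] := idealJ1.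
pose ev (H : VG_sol s f J) : resC {ffun 'I_t -> V} :=
  [ffun i => p i *: (val H : V)].
have evS H : ev H \in sys_solutions V (Syz J p).
  apply/asboolP => q Jq; have /asboolP HJ := valP H.
  rewrite -[RHS](HJ _ Jq) scaler_suml; apply: eq_bigr => i _.
  by rewrite ffunE scalerA.
pose phi (H : VG_sol s f J) : VG_sys_sol s f (Syz J p) := Subspace (evS H).
have phi_lin : linear phi.
  move=> c H K; apply/val_inj/ffunP => i; rewrite !ffunE.
  have -> : val (c *: H + K) = lpdoC (val c) *: (val H : V) + (val K : V) :> V by [].
  by rewrite scalerDr scalerA -lpdoC_central -scalerA.
pose phiL : {linear VG_sol s f J -> VG_sys_sol s f (Syz J p)} :=
  HB.pack phi (GRing.isLinear.Build _ _ _ _ phi phi_lin).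
apply: (@lquot_isomorphic _ _ _ _ phiL) => [H|w].
  split=> [/(congr1 val)/ffunP evH0|/asboolP HJ1].
    apply/asboolP => a; rewrite genJ1 => -[q ->].
    rewrite scaler_suml big1 // => i _; have := evH0 i; rewrite !ffunE => pH.
    by rewrite -scalerA pH scaler0.
  apply/val_inj/ffunP => i; rewrite !ffunE; apply: HJ1; rewrite genJ1.
  exists (fun j => (j == i)%:R); rewrite (bigD1 i) //= eqxx mul1r.
  by rewrite big1 ?addr0 // => j /negPf->; rewrite mul0r.
have /asboolP wS := valP w; set w' : {ffun 'I_t -> V} := val w in wS.
(* Well defined: two expressions of [a] differ by a syzygy with sum 0, an element of J, and [w']
   satisfies it. *)
have /choice[psi psiP] (a : lpdo F) : exists v : V, forall q : 'I_t -> lpdo F,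
    a = \sum_i q i * p i -> v = \sum_i q i *: w' i.
  have [[q ->]|na] := pselect (exists q, a = \sum_i q i * p i); last first.
    by exists 0 => q aq; case: na; exists q.
  exists (\sum_i q i *: w' i) => r qr; apply/eqP; rewrite -subr_eq0; apply/eqP.
  rewrite -[RHS](wS [ffun i => q i - r i]).
    by rewrite -sumrB; apply: eq_bigr => i _; rewrite ffunE scalerBl.
  rewrite /Syz /= (eq_bigr (fun i => q i * p i - r i * p i)) => [|i _].
    by rewrite sumrB qr subrr.
  by rewrite ffunE mulrBl.
have psi_hom : act_hom f J1 (psi : lpdo F -> frac_ser F s).
  split=> // [a b|a b]; rewrite genJ1 => -[q ->].
    move=> [r ->]; rewrite (psiP _ (fun i => q i + r i)); last first.
      by rewrite -big_split; apply: eq_bigr => i _; rewrite mulrDl.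
    rewrite (psiP _ q) // (psiP _ r) // -big_split; apply: eq_bigr => i _.
    by rewrite scalerDl.
  rewrite (psiP _ (fun i => a * q i)); last first.
    by rewrite mulr_sumr; apply: eq_bigr => i _; rewrite mulrA.
  rewrite (psiP _ q) // -[RHS]/(a *: (\sum_i q i *: w' i : V)) scaler_sumr.
  apply: eq_bigr => i _.
  by rewrite scalerA.
have [H HP] := VG_injective charF0 closedF s_pos psi_hom.
(* If a = sum q_i p_i lies in J, then q is a relative syzygy, so a H = sum q_i w_i = 0. *)
have HJ : (H : resC V) \in solutions V J.
  apply/asboolP => a Ja; have := JJ1 _ Ja; rewrite genJ1 => -[q aq].
  have J1a : J1 a by exact: JJ1.
  rewrite -[LHS]/(act f a H) -HP // (psiP _ q aq).
  rewrite -[RHS](wS (finfun q)); first by apply: eq_bigr => i _; rewrite ffunE.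
  by rewrite /Syz /= (eq_bigr (fun i => q i * p i)) -?aq // => i _; rewrite ffunE.
exists (Subspace HJ); apply/val_inj/ffunP => i; rewrite !ffunE.
(* This expression of p_i by a unit vector shows that [psi] sends p_i to w_i. *)
have pi : p i = \sum_j (j == i)%:R * p j.
  rewrite (bigD1 i) //= eqxx mul1r big1 ?addr0 // => j /negPf->.
  by rewrite mul0r.
rewrite -[LHS]/(act f (p i) H) -HP; last by rewrite genJ1; exists (fun j => (j == i)%:R).
rewrite (psiP _ _ pi) (bigD1 i) //= eqxx scale1r big1 ?addr0 // => j /negPf->.
by rewrite scale0r.
Qed.
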